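(* Let $q,t,\beta,\alpha,\gamma\in\mathbb C$ with $0<|q|<1$, $|t|<1$, $0<|\alpha|<1$, $|\gamma|<1$, and let $x=\cos\theta\in[-1,1]$. Then $$\frac{(t\beta e^{i\theta},t\beta e^{-i\theta};q)_\infty}{(te^{i\theta},te^{-i\theta};q)_\infty}=\sum_{n=0}^\infty d_n(\beta,t,\alpha,\gamma,q)\,P_n^{(\alpha,\gamma)}(x|q),$$ where $$d_n(\beta,t,\alpha,\gamma,q)=\frac{(t\alpha^{-\frac12})^n(\beta,-(\alpha\gamma)^{\frac12},-(q\alpha\gamma)^{\frac12};q)_n}{(q^n\alpha\gamma;q)_n}\cdot\frac{(q^n\alpha^{\frac12}\beta t,\,-q^n\gamma^{\frac12}\beta t,\,-q^{n+\frac12}\gamma^{\frac12}\beta t,\,q^{n+\frac12}\alpha^{\frac12}\gamma t;q)_\infty}{(\alpha^{\frac12}t,\,-\gamma^{\frac12}t,\,-(q\gamma)^{\frac12}t,\,q^{2n+\frac12}\alpha^{\frac12}\gamma\beta t;q)_\infty}\,\Phi_n$$ and $$\Phi_n={}_8\phi_7\left(\begin{array}{c}q^{2n-\frac12}\alpha^{\frac12}\gamma\beta t,\ \pm q^{n+\frac34}\alpha^{\frac14}(\gamma\beta t)^{\frac12},\ -q^n(\alpha\gamma)^{\frac12},\ -q^{n+\frac12}(\alpha\gamma)^{\frac12},\ q^{n+\frac12}\gamma,\ (q\alpha)^{-\frac12}\beta t,\ q^n\beta\\ \pm q^{n-\frac14}\alpha^{\frac14}(\gamma\beta t)^{\frac12},\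 q^n\alpha^{\frac12}\beta t,\ -q^n\gamma^{\frac12}\beta t,\ -q^{n+\frac12}\gamma^{\frac12}\beta t,\ q^{2n+1}\alpha\gamma,\ q^{n+\frac12}\alpha^{\frac12}\gamma t\end{array};q,(q\alpha)^{\frac12}t\right).$$
   Context: In a list of parameters, $\pm c$ stands for the two entries $c,-c$. Fractional powers denote fixed, mutually consistent choices of roots (e.g. $(\alpha\gamma)^{1/2}=\alpha^{1/2}\gamma^{1/2}$, $(q\alpha)^{1/2}=q^{1/2}\alpha^{1/2}$, $(q\gamma)^{1/2}=q^{1/2}\gamma^{1/2}$). $q$-Pochhammer symbols: $(a;q)_0=1$, $(a;q)_n=(1-a)(1-aq)\cdots(1-aq^{n-1})$, $(a;q)_\infty=\prod_{n\ge0}(1-aq^n)$, and $(a_1,\ldots,a_r;q)_n=(a_1;q)_n\cdots(a_r;q)_n$ (also for $n=\infty$). Basic hypergeometric series: ${}_r\phi_s\left(\begin{array}{c}a_1,\ldots,a_r\\ b_1,\ldots,b_s\end{array};q,z\right)=\sum_{k=0}^\infty\frac{(a_1,\ldots,a_r;q)_k}{(q,b_1,\ldots,b_s;q)_k}\left((-1)^kq^{\binom k2}\right)^{1+s-r}z^k$. The continuous $q$-Jacobi polynomials, in the rescaled notation where $\alpha,\gamma$ stand for what is usually written $q^{\alpha+\frac12},q^{\gamma+\frac12}$, are $$P_n^{(\alpha,\gamma)}(x|q)=\frac{(q^{\frac12}\alpha;q)_n}{(q;q)_n}\,{}_4\phi_3\left(\begin{array}{c}q^{-n},\ q^n\alpha\gamma,\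 \alpha^{\frac12}e^{i\theta},\ \alpha^{\frac12}e^{-i\theta}\\ q^{\frac12}\alpha,\ -(\alpha\gamma)^{\frac12},\ -(q\alpha\gamma)^{\frac12}\end{array};q,q\right),\quad x=\cos\theta.$$ *)

(* Defs.v *)
(* Stdlib reals with Coquelicot's complex numbers. *)
From Stdlib Require Import Reals List ZArith.
From Coquelicot Require Import Coquelicot.
Import ListNotations.
Open Scope C_scope.

(* Componentwise limit; a junk value when [u] does not converge in C. *)
Definition Clim (u : nat -> C) : C :=
  (real (Lim_seq (fun n => Re (u n))), real (Lim_seq (fun n => Im (u n)))).

Definition Csum_inf (a : nat -> C) : C := Clim (fun n => sum_n a n).

Definition Cpowz (c : C) (m : Z) : C :=
  match m with
  | Z0 => 1
  | Zpos p => c ^ Pos.to_nat p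
  | Zneg p => / (c ^ Pos.to_nat p)
  end.

Definition expi (theta : R) : C := (cos theta, sin theta).

Fixpoint qpoch (a q : C) (n : nat) : C :=
  match n with
  | O => 1
  | S m => qpoch a q m * (1 - a * q ^ m)
  end.

Definition qpoch_inf (a q : C) : C := Clim (qpoch a q).

Definition Cprod (l : list C) : C := fold_right Cmult 1 l.

Definition qpochs (l : list C) (q : C) (n : nat) : C :=
  Cprod (map (fun a => qpoch a q n) l).

Definition qpochs_inf (l : list C) (q : C) : C :=
  Cprod (map (fun a => qpoch_inf a q) l).

(* No factor [1 - b q^k] vanishes, i.e. [qpoch b q k <> 0] for all [k]. *)
Definition qregular (q b : C) : Prop := forall k : nat, b * q ^ k <> 1.

(* [Nat.div2 (k * (k - 1))] is the binomial coefficient "k choose 2". *)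
Definition rphis (a b : list C) (q z : C) : C :=
  Csum_inf (fun k =>
    qpochs a q k / qpochs (q :: b) q k
    * Cpowz ((- (1)) ^ k * q ^ Nat.div2 (k * (k - 1)))
            (1 + Z.of_nat (length b) - Z.of_nat (length a))
    * z ^ k).

(* In what follows q12, q14, al12, al14, ga12 stand for chosen roots q^(1/2),
   q^(1/4), alpha^(1/2), alpha^(1/4), gamma^(1/2), and w for a chosen square
   root of gamma beta t; all other fractional powers are products of these,
   e.g. (q alpha gamma)^(1/2) = q12 * al12 * ga12. *)

(* The variable is x = cos theta with theta := acos x, for -1 <= x <= 1. *)
Definition cqJacobi (alpha gamma q q12 al12 ga12 : C) (n : nat) (x : R) : C :=
  qpoch (q12 * alpha) q n / qpoch q q n
  * rphis [/ q ^ n; q ^ n * alpha * gamma;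
           al12 * expi (acos x); al12 * expi (- acos x)]
          [q12 * alpha; - (al12 * ga12); - (q12 * al12 * ga12)]
          q q.

Definition Phi_upper (beta t alpha gamma q q12 q14 al12 al14 ga12 w : C)
    (n : nat) : list C :=
  [q ^ (2 * n) / q12 * al12 * gamma * beta * t;
   q ^ n * q14 ^ 3 * al14 * w; - (q ^ n * q14 ^ 3 * al14 * w);
   - (q ^ n * al12 * ga12);
   - (q ^ n * q12 * al12 * ga12);
   q ^ n * q12 * gamma;
   / (q12 * al12) * beta * t;
   q ^ n * beta].

Definition Phi_lower (beta t alpha gamma q q12 q14 al12 al14 ga12 w : C)
    (n : nat) : list C :=
  [q ^ n / q14 * al14 * w; - (q ^ n / q14 * al14 * w);
   q ^ n * al12 * beta * t;
   - (q ^ n * ga12 * beta * t);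
   - (q ^ n * q12 * ga12 * beta * t);
   q ^ (2 * n + 1) * alpha * gamma;
   q ^ n * q12 * al12 * gamma * t].

Definition Phi (beta t alpha gamma q q12 q14 al12 al14 ga12 w : C)
    (n : nat) : C :=
  rphis (Phi_upper beta t alpha gamma q q12 q14 al12 al14 ga12 w n)
        (Phi_lower beta t alpha gamma q q12 q14 al12 al14 ga12 w n)
        q (q12 * al12 * t).

Definition d_lower (beta t gamma q q12 al12 ga12 : C) (n : nat) : list C :=
  [al12 * t; - (ga12 * t); - (q12 * ga12 * t);
   q ^ (2 * n) * q12 * al12 * gamma * beta * t].

Definition d_coef (beta t alpha gamma q q12 q14 al12 al14 ga12 w : C)
    (n : nat) : C :=
  (t / al12) ^ n
  * qpochs [beta; - (al12 * ga12); - (q12 * al12 * ga12)] q n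
  / qpoch (q ^ n * alpha * gamma) q n
  * (qpochs_inf [q ^ n * al12 * beta * t;
                 - (q ^ n * ga12 * beta * t);
                 - (q ^ n * q12 * ga12 * beta * t);
                 q ^ n * q12 * al12 * gamma * t] q
     / qpochs_inf (d_lower beta t gamma q q12 al12 ga12 n) q)
  * Phi beta t alpha gamma q q12 q14 al12 al14 ga12 w n.

(* Main.v *)
Require Import Defs.
From Stdlib Require Import Reals List Lia Lra ZArith.
From Coquelicot Require Import Coquelicot.
Import ListNotations.
Open Scope C_scope.

(* Put a = alpha^(1/2), b = (q alpha)^(1/2), c = -gamma^(1/2), d = -(q gamma)^(1/2) and
   g = beta t; the continuous q-Jacobi polynomials are the Askey-Wilson polynomials
   p_n(x; a, b, c, d).

   With g fixed, the quotient (g e^(+-i theta))_oo / (t e^(+-i theta))_oo expands in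
   p_N(x; a, g, c, d), which do not depend on t, with coefficients containing the Newton
   factor prod_(i < N) (t - g q^i).  Indeed, by the three-term recurrence, the sum V(t)
   multiplied by (at, ct, dt)_oo satisfies
     (1 - 2 x t + t^2) V(t) = (1 - a t)(1 - c t)(1 - d t) V(q t),
   so V is determined by V(0), and V(0) is found by starting at t = g instead, where the
   sum has a single term.

   The passage from p_N(x; a, g, c, d) to p_n(x; a, b, c, d) changes a single parameter; its
   coefficients come from the terminating 6phi5 sum.  Interchanging the summations, the
   inner sum over N = n + k is the very-well-poised 8phi7.  The interchange is justified by
   a geometric bound on p_n, read off from the three-term recurrence. *)

(** * Terminating very-well-poised sums *)

(** Taking the parameter g in the auxiliary polynomials is what makes the coefficients of the
    quotient pure products. Starting at t = g needs the sum at every point g q^k, although |g| may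
    exceed 1 and the general convergence proof wants |t| < 1. At these points the Newton factor
    vanishes for N > k, so each sum is finite; uniform bounds enter only in the limit k -> oo, where
    g q^k is small. This is why individual bounds at each point and a uniform bound on a disc are
    kept apart. For |z| = 1 both roots z, z' of the limiting characteristic equation lie on the unit
    circle, and they coincide at x = 1 and x = -1, where a^(-n) p_n may grow linearly. Hence only a
    rate rho > 1 is claimed; rho is chosen so close to 1 that the decay in t still wins. Since c, d,
    g and t may be 0, quotients such as (g / t; q)_N are replaced throughout by polynomial
    products. *)

Fixpoint csum (f : nat -> C) (n : nat) : C :=
  match n with
  | O => 0
  | S m => csum f m + f m
  end.

Lemma csum_S (f : nat -> C) n : csum f (S n) = csum f n + f n.
Proof. reflexivity. Qed.

Lemma csum_ext (f g : nat -> C) n : (forall i, (i < n)%nat -> f i = g i) -> csum f n = csum g n.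
Proof.
  induction n as [|n IH]; intros H; simpl; [easy|].
  rewrite IH by (intros; apply H; lia). now rewrite H by lia.
Qed.

Lemma csum_zero (f : nat -> C) n : (forall i, (i < n)%nat -> f i = 0) -> csum f n = 0.
Proof.
  induction n as [|n IH]; intros H; simpl; [easy|].
  rewrite IH by (intros; apply H; lia). rewrite H by lia. ring.
Qed.

Lemma csum_scal (k : C) (f : nat -> C) n : csum (fun i => k * f i) n = k * csum f n.
Proof. induction n as [|n IH]; simpl; [ring|]. rewrite IH. ring. Qed.

Lemma csum_add (f g : nat -> C) n : csum (fun i => f i + g i) n = csum f n + csum g n.
Proof. induction n as [|n IH]; simpl; [ring|]. rewrite IH. ring. Qed.

Lemma csum_sub (f g : nat -> C) n : csum (fun i => f i - g i) n = csum f n - csum g n.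
Proof. induction n as [|n IH]; simpl; [ring|]. rewrite IH. ring. Qed.

Lemma csum_split (f : nat -> C) m n : csum f (m + n) = csum f m + csum (fun i => f (m + i)%nat) n.
Proof.
  induction n as [|n IH]; [rewrite Nat.add_0_r; simpl; ring|].
  rewrite Nat.add_succ_r. simpl. rewrite IH. ring.
Qed.

Lemma csum_exchange (f : nat -> nat -> C) m n :
  csum (fun i => csum (f i) n) m = csum (fun j => csum (fun i => f i j) m) n.
Proof.
  induction m as [|m IH]; simpl.
  - symmetry. now apply csum_zero.
  - rewrite IH, csum_add. reflexivity.
Qed.

Lemma Cmult_cancel_l (k x y : C) : k <> 0 -> k * x = k * y -> x = y.
Proof.
  intros Hk H. replace x with (/ k * (k * x)) by (field; auto).
  rewrite H. field. auto.
Qed.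

Lemma one_minus_neq0 (x : C) : x <> 1 -> 1 - x <> 0.
Proof. intros H E. apply H. replace x with (1 - (1 - x)) by ring. rewrite E. ring. Qed.

Lemma qpoch_Sl (a q : C) n : qpoch a q (S n) = (1 - a) * qpoch (a * q) q n.
Proof.
  induction n as [|n IH]; [simpl; ring|].
  change (qpoch a q (S n) * (1 - a * q ^ S n) =
          (1 - a) * (qpoch (a * q) q n * (1 - a * q * q ^ n))).
  rewrite IH, Cpow_S. ring.
Qed.

Lemma qpoch_add (a q : C) m n : qpoch a q (m + n) = qpoch a q m * qpoch (a * q ^ m) q n.
Proof.
  induction n as [|n IH]; [rewrite Nat.add_0_r; simpl; ring|].
  rewrite Nat.add_succ_r. simpl. rewrite IH, Cpow_add_r. ring.
Qed.

Lemma qpoch_neq0 (a q : C) n : (forall k, (k < n)%nat -> a * q ^ k <> 1) -> qpoch a q n <> 0.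
Proof.
  induction n as [|n IH]; intros H; simpl.
  - apply C1_nz.
  - apply Cmult_neq_0.
    + apply IH. intros; apply H; lia.
    + apply one_minus_neq0, H; lia.
Qed.

Lemma qregular_neq0 (a q : C) n : qregular q a -> qpoch a q n <> 0.
Proof. intros H. apply qpoch_neq0. auto. Qed.

Lemma qregular_shift (a q : C) m : qregular q a -> qregular q (a * q ^ m).
Proof. intros H k. rewrite <- Cmult_assoc, <- Cpow_add_r. apply H. Qed.

(* [u ^ n * (v / u; q)_n], polynomial in [u] and [v] and so meaningful at [u = 0]. *)
Fixpoint newton (u v q : C) (n : nat) : C :=
  match n with
  | O => 1
  | S m => newton u v q m * (u - v * q ^ m)
  end.

Lemma newton_scal (k u v q : C) n : newton (k * u) (k * v) q n = k ^ n * newton u v q n.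
Proof. induction n as [|n IH]; simpl; [ring|]. rewrite IH. ring. Qed.

Lemma newton_shift (u v q : C) n :
  newton (q * u) v q (S n) = (q * u - v) * q ^ n * newton u v q n.
Proof.
  induction n as [|n IH]; [simpl; ring|].
  change (newton (q * u) v q (S n) * (q * u - v * q ^ S n)
          = (q * u - v) * q ^ S n * (newton u v q n * (u - v * q ^ n))).
  rewrite IH, Cpow_S. ring.
Qed.

(* Summand of a terminating 6phi5 with parameters [b h / q], [b], [g h / q * q ^ M], [q ^ (- M)],
   rearranged so that nothing is divided by [b] or [g]. *)
Definition wz_term (b g h q : C) (M m : nat) : C :=
  newton b g q (M - m) * qpoch b q m * (1 - b * h / q * q ^ (2 * m))
  * qpoch (g * h / q * q ^ M) q m
  / (qpoch q q (M - m) * qpoch q q m * qpoch (b * h / q * q ^ m) q (S M) * qpoch h q m).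

(** The companion of [wz_term] in a Wilf-Zeilberger pair: its differences in [m] reproduce a
    first-order recurrence in [M] applied to the summand. *)
Definition wz_cert (b g h q : C) (M m : nat) : C :=
  - (qpoch b q (S m) * (1 - g * h * q ^ (2 * M)) * newton b g q (M - m)
     * qpoch (g * h / q * q ^ S M) q m
     / (qpoch q q (M - m) * qpoch q q m * qpoch (b * h / q * q ^ S m) q (S M)
        * qpoch h q m)).

(* [field] returns the denominators expanded and possibly scaled; they are matched with
   the hypotheses up to a factor [1], [k] or [k ^ 2]. *)
Ltac field_side k :=
  cbv beta; repeat split; auto;
  match goal with
  | H : ?y <> _ |- ?x <> _ =>
      first [ replace x with y; [exact H | solve [field; auto]]
            | replace x with (k * y); [apply Cmult_neq_0; auto | solve [field; auto]]
            | replace x with (k * (k * y));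
              [repeat apply Cmult_neq_0; auto | solve [field; auto]] ]
  end.

(** Once the common Pochhammer symbols are split off, this is a rational identity in [q ^ m] and
    [q ^ r] with [r = M - S m]. The bound [S m <= M] keeps the truncated differences genuine. *)
Lemma wz_step (b g h q : C) (M m : nat) :
  q <> 0 -> qregular q q -> qregular q (b * h / q) -> qregular q h ->
  (S m <= M)%nat ->
  (1 - q ^ S M) * (1 - h * q ^ M) * wz_term b g h q (S M) (S m)
  - (1 - g * q ^ M) * wz_term b g h q M (S m)
  = wz_cert b g h q M (S m) - wz_cert b g h q M m.
Proof.
  intros q0 rq re rh Hm.
  set (r := (M - S m)%nat).
  assert (EM : M = (S m + r)%nat) by (unfold r; lia).
  unfold wz_term, wz_cert.
  replace (S M - S m)%nat with (S r) by lia.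
  replace (M - S m)%nat with r by lia.
  replace (M - m)%nat with (S r) by lia.
  set (e := b * h / q) in *. set (s := g * h / q).
  assert (Hg : g * h = s * q) by (unfold s; field; auto).
  set (Z := qpoch (s * q ^ S M) q m).
  set (Y := qpoch (e * q ^ S (S m)) q M).
  assert (E1 : qpoch (s * q ^ S M) q (S m) = Z * (1 - s * q ^ S M * q ^ m)) by reflexivity.
  assert (E2 : qpoch (s * q ^ M) q (S m) = (1 - s * q ^ M) * Z).
  { rewrite qpoch_Sl. unfold Z. do 2 f_equal. rewrite Cpow_S. ring. }
  assert (E3 : qpoch (e * q ^ S m) q (S M) = (1 - e * q ^ S m) * Y).
  { rewrite qpoch_Sl. unfold Y. do 2 f_equal. rewrite (Cpow_S _ (S m)). ring. }
  assert (E4 : qpoch (e * q ^ S m) q (S (S M)) = (1 - e * q ^ S m) * (Y * (1 - e * q ^ S (S m) * q ^ M))).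
  { rewrite qpoch_Sl. unfold Y.
    replace (e * q ^ S m * q) with (e * q ^ S (S m)) by (rewrite (Cpow_S _ (S m)); ring).
    reflexivity. }
  assert (E5 : qpoch (e * q ^ S (S m)) q (S M) = Y * (1 - e * q ^ S (S m) * q ^ M)) by reflexivity.
  clearbody r. rewrite E1, E2, E3, E4, E5.
  assert (nY : Y <> 0) by (apply qregular_neq0, qregular_shift; auto).
  assert (n1 : 1 - e * q ^ S m <> 0) by (apply one_minus_neq0, re).
  assert (n2 : 1 - e * q ^ S (S m) * q ^ M <> 0).
  { apply one_minus_neq0. rewrite <- Cmult_assoc, <- Cpow_add_r. apply re. }
  cbn [qpoch newton].
  assert (n3 : qpoch q q r <> 0) by (apply qregular_neq0; auto).
  assert (n4 : qpoch q q m <> 0) by (apply qregular_neq0; auto).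
  assert (n5 : qpoch h q m <> 0) by (apply qregular_neq0; auto).
  assert (n6 : 1 - q * q ^ r <> 0) by (apply one_minus_neq0, rq).
  assert (n7 : 1 - q * q ^ m <> 0) by (apply one_minus_neq0, rq).
  assert (n8 : 1 - h * q ^ m <> 0) by (apply one_minus_neq0, rh).
  clearbody Y Z. clear E1 E2 E3 E4 E5.
  generalize dependent (qpoch q q r). generalize dependent (qpoch q q m).
  generalize dependent (qpoch h q m). intros ph nph pm npm pr npr.
  generalize (qpoch b q m) (newton b g q r). intros pb nw.
  revert n1 n2 n6 n7 n8. rewrite Hg. subst M. clear Hm.
  unfold e, s.
  replace (2 * (S m + r))%nat with (S m + r + (S m + r))%nat by lia.
  replace (2 * S m)%nat with (S m + S m)%nat by lia.
  rewrite ?Cpow_S, ?Cpow_add_r, ?Cpow_S.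
  generalize (q ^ m) (q ^ r). intros X R n1 n2 n6 n7 n8.
  field. field_side q.
Qed.

(** Summing [wz_step] over [m] telescopes and leaves the recurrence (1 - q^(M+1)) (1 - h q^M) F(M+1)
    = (1 - g q^M) F(M) for the sum F, which the right-hand side satisfies as well. *)
Lemma terminating_6phi5_sum (b g h q : C) (M : nat) :
  q <> 0 -> qregular q q -> qregular q (b * h / q) -> qregular q h ->
  csum (wz_term b g h q M) (S M) = qpoch g q M / (qpoch q q M * qpoch h q M).
Proof.
  intros q0 rq re rh.
  assert (Hpart : forall M m, (m <= M)%nat ->
    csum (fun m => (1 - q ^ S M) * (1 - h * q ^ M) * wz_term b g h q (S M) m
                   - (1 - g * q ^ M) * wz_term b g h q M m) (S m)
    = wz_cert b g h q M m).
  { clear M. intros M m. induction m as [|m IH]; intros Hm.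
    - unfold csum, wz_term, wz_cert.
      rewrite !Nat.sub_0_r, !Nat.mul_0_r. cbn [qpoch newton].
      assert (n3 : qpoch q q M <> 0) by (apply qregular_neq0; auto).
      assert (n6 : 1 - q * q ^ M <> 0) by (apply one_minus_neq0, rq).
      rewrite !Cmult_1_r.
      set (e := b * h / q) in *.
      assert (E1 : qpoch e q M * (1 - e * q ^ M) = (1 - e) * qpoch (e * q) q M)
        by apply (qpoch_Sl e q M).
      rewrite E1. rewrite !Cpow_1_r.
      assert (n1 : 1 - e <> 0) by (apply one_minus_neq0; rewrite <- (Cmult_1_r e); apply (re 0%nat)).
      assert (n2 : qpoch (e * q) q M <> 0).
      { replace (e * q) with (e * q ^ 1) by (simpl; ring). apply qregular_neq0, qregular_shift; auto. }
      assert (n5 : 1 - e * q * q ^ M <> 0).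
      { apply one_minus_neq0. rewrite <- Cmult_assoc, <- Cpow_S. apply re. }
      generalize dependent (qpoch q q M). generalize dependent (qpoch (e * q) q M).
      generalize (newton b g q M). intros nw Y _ nY pq npq.
      revert n1 n5 n6. unfold e. replace (2 * M)%nat with (M + M)%nat by lia.
      rewrite Cpow_S, Cpow_add_r.
      generalize (q ^ M). intros R n1 n5 n6.
      field. field_side q.
    - rewrite csum_S, IH by lia. rewrite wz_step by (auto; lia). ring. }
  induction M as [|M IH].
  - unfold csum, wz_term. simpl.
    assert (n1 : 1 - b * h / q <> 0).
    { apply one_minus_neq0. rewrite <- (Cmult_1_r (b * h / q)); apply (re 0%nat). }
    field. field_side q.
  - assert (n3 : forall n, qpoch q q n <> 0) by (intros; apply qregular_neq0; auto).
    assert (n4 : forall n, qpoch h q n <> 0) by (intros; apply qregular_neq0; auto).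
    assert (n6 : 1 - q ^ S M <> 0) by (apply one_minus_neq0; rewrite Cpow_S; apply rq).
    assert (n7 : 1 - h * q ^ M <> 0) by (apply one_minus_neq0, rh).
    assert (HP := Hpart M M (le_n M)).
    (* The index [S M] occurs only in the sum for [S M]; its term cancels the boundary value of the
       certificate. *)
    assert (Hlast : (1 - q ^ S M) * (1 - h * q ^ M) * wz_term b g h q (S M) (S M)
                    = - wz_cert b g h q M M).
    { unfold wz_term, wz_cert. rewrite !Nat.sub_diag.
      set (e := b * h / q) in *.
      assert (E4 : qpoch (e * q ^ S M) q (S (S M))
        = qpoch (e * q ^ S M) q (S M) * (1 - e * q ^ S M * q ^ S M)) by reflexivity.
      rewrite E4.
      assert (n8 : qpoch (e * q ^ S M) q (S M) <> 0) by (apply qregular_neq0, qregular_shift; auto).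
      assert (n9 : 1 - e * q ^ S M * q ^ S M <> 0).
      { apply one_minus_neq0. rewrite <- Cmult_assoc, <- Cpow_add_r. apply re. }
      replace (2 * S M)%nat with (S M + S M)%nat by lia. rewrite Cpow_add_r.
      assert (E5 : qpoch (g * h / q * q ^ S M) q (S M)
        = qpoch (g * h / q * q ^ S M) q M * (1 - g * h * q ^ (2 * M))).
      { change (qpoch (g * h / q * q ^ S M) q M * (1 - g * h / q * q ^ S M * q ^ M)
          = qpoch (g * h / q * q ^ S M) q M * (1 - g * h * q ^ (2 * M))).
        replace (2 * M)%nat with (M + M)%nat by lia.
        rewrite Cpow_add_r, Cpow_S. field. auto. }
      rewrite E5.
      generalize dependent (qpoch (e * q ^ S M) q (S M)). intros Y _ nY.
      assert (E6 : qpoch q q (S M) = qpoch q q M * (1 - q ^ S M)) by reflexivity.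
      assert (E7 : qpoch h q (S M) = qpoch h q M * (1 - h * q ^ M)) by reflexivity.
      rewrite E6, E7.
      generalize (qpoch b q (S M)) (qpoch (g * h / q * q ^ S M) q M).
      assert (n10 := n3 M). assert (n11 := n4 M). simpl (newton _ _ _ 0). simpl (qpoch _ _ 0).
      revert n9 n10 n11 n6 n7.
      generalize (qpoch q q M) (qpoch h q M) (q ^ S M) (q ^ M) (q ^ (2 * M)).
      intros. field. repeat split; auto. }
    assert (Hs : (1 - q ^ S M) * (1 - h * q ^ M) * csum (wz_term b g h q (S M)) (S M)
      - (1 - g * q ^ M) * csum (wz_term b g h q M) (S M) = wz_cert b g h q M M).
    { now rewrite <- HP, csum_sub, !csum_scal. }
    change (csum (wz_term b g h q (S M)) (S (S M))) with
      (csum (wz_term b g h q (S M)) (S M) + wz_term b g h q (S M) (S M)).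
    apply Cmult_cancel_l with ((1 - q ^ S M) * (1 - h * q ^ M)); [apply Cmult_neq_0; auto|].
    rewrite Cmult_plus_distr_l, Hlast, <- Hs, IH.
    assert (E6 : qpoch q q (S M) = qpoch q q M * (1 - q ^ S M)) by reflexivity.
    assert (E7 : qpoch h q (S M) = qpoch h q M * (1 - h * q ^ M)) by reflexivity.
    assert (E8 : qpoch g q (S M) = qpoch g q M * (1 - g * q ^ M)) by reflexivity.
    rewrite E6, E7, E8.
    assert (n10 := n3 M). assert (n11 := n4 M).
    field. auto.
Qed.

(** * Askey-Wilson polynomials *)

Definition aw_coef (q a b c d : C) (n j : nat) : C :=
  qpoch (/ q ^ n) q j * qpoch (a * b * c * d / q * q ^ n) q j * q ^ j
  / (qpoch q q j * (qpoch (a * b) q j * qpoch (a * c) q j * qpoch (a * d) q j)).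

Definition aw_basis (q a z z' : C) (j : nat) : C := qpoch (a * z) q j * qpoch (a * z') q j.

(** The bare 4phi3, without the customary factor (ab, ac, ad; q)_n / a^n. [z] and [z'] stand for
    e^(i theta) and e^(-i theta). *)
Definition aw_poly (q a b c d z z' : C) (n : nat) : C :=
  csum (fun j => aw_coef q a b c d n j * aw_basis q a z z' j) (S n).

Lemma qpoch_neg_power_vanish (q : C) n j : q <> 0 -> (n < j)%nat -> qpoch (/ q ^ n) q j = 0.
Proof.
  intros q0 H. replace j with (S n + (j - S n))%nat by lia.
  rewrite qpoch_add. cbn [qpoch]. assert (q ^ n <> 0) by now apply Cpow_nz.
  replace (1 - / q ^ n * q ^ n) with (RtoC 0) by (field; auto). ring.
Qed.

Lemma aw_coef_vanish (q a b c d : C) n j : q <> 0 -> (n < j)%nat -> aw_coef q a b c d n j = 0.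
Proof.
  intros q0 H. unfold aw_coef. rewrite qpoch_neg_power_vanish by auto.
  unfold Cdiv. ring.
Qed.

Lemma aw_poly_extend (q a b c d z z' : C) n K : q <> 0 -> (n <= K)%nat ->
  aw_poly q a b c d z z' n = csum (fun j => aw_coef q a b c d n j * aw_basis q a z z' j) (S K).
Proof.
  intros q0 H. replace (S K) with (S n + (K - n))%nat by lia.
  rewrite csum_split. fold (aw_poly q a b c d z z' n).
  match goal with |- _ = _ + ?s => assert (E : s = 0) end; [|rewrite E; ring].
  apply csum_zero. intros i Hi. rewrite aw_coef_vanish by (auto; lia). ring.
Qed.

(* The constant in the reversal of [(q^(-n); q)_j]. *)
Fixpoint reversal_sign (q : C) (j : nat) : C :=
  match j with
  | O => 1
  | S i => reversal_sign q i * - / q ^ S i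
  end.

(** Isolates the dependence on [m], so that [reversal_sign] and powers of [q ^ j] can be taken out
    of the sums over n = j + m. *)
Lemma qpoch_neg_power (q : C) j m : q <> 0 ->
  qpoch (/ q ^ (j + m)) q j * qpoch q q m * (q ^ j) ^ m = reversal_sign q j * qpoch q q (j + m).
Proof.
  intros q0. revert m. induction j as [|j IH]; intros m.
  - simpl. rewrite Cpow_1_l. ring.
  - cbn [qpoch reversal_sign]. rewrite Nat.add_succ_comm.
    specialize (IH (S m)). cbn [qpoch] in IH.
    assert (q ^ j <> 0) by now apply Cpow_nz.
    assert (q ^ m <> 0) by now apply Cpow_nz.
    assert (E : 1 - / q ^ (j + S m) * q ^ j = - (1 - q * q ^ m) / (q * q ^ m)).
    { rewrite Cpow_add_r, Cpow_S. field. auto. }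
    rewrite E.
    assert (E2 : (q ^ S j) ^ m = (q ^ j) ^ S m * q ^ m / q ^ j).
    { rewrite !Cpow_S, Cpow_mult_l. field. auto. }
    rewrite E2.
    transitivity (qpoch (/ q ^ (j + S m)) q j * (qpoch q q m * (1 - q * q ^ m)) * (q ^ j) ^ S m
                  * - / q ^ S j).
    { rewrite (Cpow_S q j). field. auto. }
    rewrite IH. ring.
Qed.

(** * Change of one parameter *)

(** Up to normalization, the coefficient of p_n(x; a, b, c, d) in p_N(x; a, g, c, d). The Newton
    product avoids dividing by b or g; for g = b it leaves only n = N. *)
Definition connection_coef (q a b c d g : C) (N n : nat) : C :=
  / a ^ n * newton b g q (N - n) * qpoch (a * g * c * d / q * q ^ N) q n
  / (qpoch q q (N - n) * qpoch (q ^ n * (a * b * c * d / q)) q n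
     * qpoch (q ^ (2 * n + 1) * (a * b * c * d / q)) q (N - n) * qpoch (c * d) q n).

(** With n = j + m, the two symbols on the left skip exactly one factor, 1 - D q^(2n). Inserting it
    gives an unbroken run, which is then cut after j factors: the first piece cancels in [aw_coef],
    the second is a denominator of [wz_term], and the inserted factor is its very-well-poised
    part. *)
Lemma qpoch_well_poised_merge (D q : C) j m M : (m <= M)%nat ->
  qpoch (q ^ (j + m) * D) q (j + m) * qpoch (q ^ (2 * (j + m) + 1) * D) q (M - m)
    * (1 - D * (q ^ j * q ^ j) * q ^ (2 * m))
  = qpoch (D * q ^ (j + m)) q j * qpoch (D * (q ^ j * q ^ j) * q ^ m) q (S M).
Proof.
  intros Hm. rewrite qpoch_add.
  replace (S M) with (m + (1 + (M - m)))%nat by lia.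
  rewrite (qpoch_add _ _ m), (qpoch_add _ _ 1).
  replace (q ^ (j + m) * D) with (D * q ^ (j + m)) by ring.
  replace (D * q ^ (j + m) * q ^ j) with (D * (q ^ j * q ^ j) * q ^ m)
    by (rewrite Cpow_add_r; ring).
  replace (D * (q ^ j * q ^ j) * q ^ m * q ^ m * q ^ 1) with (q ^ (2 * (j + m) + 1) * D).
  2:{ replace (2 * (j + m) + 1)%nat with (j + j + m + m + 1)%nat by lia.
      rewrite !Cpow_add_r. ring. }
  replace (qpoch (D * (q ^ j * q ^ j) * q ^ m * q ^ m) q 1)
    with (1 - D * (q ^ j * q ^ j) * q ^ (2 * m)).
  2:{ replace (2 * m)%nat with (m + m)%nat by lia. simpl. rewrite Cpow_add_r. ring. }
  ring.
Qed.

(** In the coefficient of the j-th basis product, the dependence on m is that of a 6phi5 with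
    parameters shifted by q^j; everything else is free of m. *)
Lemma connection_term (q a b c d g : C) (j m M : nat) :
  q <> 0 -> a <> 0 -> (m <= M)%nat ->
  qregular q q -> qregular q (a * b * c * d / q) -> qregular q (c * d) ->
  qregular q (a * b) -> qregular q (a * c) -> qregular q (a * d) ->
  connection_coef q a b c d g (j + M) (j + m)
    * (qpoch (a * b) q (j + m) / qpoch q q (j + m) * aw_coef q a b c d (j + m) j)
  = / a ^ (j + M) * / (q ^ j) ^ M * reversal_sign q j
    * qpoch (a * g * c * d / q * q ^ (j + M)) q j * q ^ j
    / (qpoch (c * d) q j * qpoch q q j * qpoch (a * c) q j * qpoch (a * d) q j)
    * wz_term (a * q ^ j * b) (a * q ^ j * g) (c * d * q ^ j) q M m.
Proof.
  intros q0 a0 Hm rq rD rcd rab rac rad. unfold connection_coef, aw_coef, wz_term.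
  replace (j + M - (j + m))%nat with (M - m)%nat by lia.
  rewrite (newton_scal (a * q ^ j)).
  set (D := a * b * c * d / q) in *. set (A := a * g * c * d / q) in *.
  replace (a * q ^ j * b * (c * d * q ^ j) / q) with (D * (q ^ j * q ^ j)) by (unfold D; field; auto).
  replace (a * q ^ j * g * (c * d * q ^ j) / q) with (A * (q ^ j * q ^ j)) by (unfold A; field; auto).
  assert (H1 := qpoch_well_poised_merge D q j m M Hm).
  assert (H2 := qpoch_neg_power q j m q0).
  assert (n1 : qpoch (q ^ (j + m) * D) q (j + m) <> 0).
  { rewrite Cmult_comm. apply qregular_neq0, qregular_shift; auto. }
  assert (n2 : qpoch (q ^ (2 * (j + m) + 1) * D) q (M - m) <> 0).
  { rewrite Cmult_comm. apply qregular_neq0, qregular_shift; auto. }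
  assert (n3 : qpoch (D * (q ^ j * q ^ j) * q ^ m) q (S M) <> 0).
  { rewrite <- Cpow_add_r. apply qregular_neq0, qregular_shift, qregular_shift; auto. }
  rewrite (qpoch_add (c * d)), (qpoch_add (a * b)), (qpoch_add (A * q ^ (j + M))).
  replace (a * b * q ^ j) with (a * q ^ j * b) by ring.
  replace (A * q ^ (j + M) * q ^ j) with (A * (q ^ j * q ^ j) * q ^ M) by (rewrite Cpow_add_r; ring).
  assert (n4 : forall x i, qregular q x -> qpoch x q i <> 0) by (intros; apply qregular_neq0; auto).
  assert (n5 := n4 q (M - m)%nat rq). assert (n6 := n4 q (j + m)%nat rq).
  assert (n7 := n4 q m rq). assert (n8 := n4 q j rq).
  assert (n9 := n4 _ j rcd). assert (n10 := n4 _ m (qregular_shift _ _ j rcd)).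
  assert (n11 := n4 _ j rab). assert (n12 := n4 _ j rac). assert (n13 := n4 _ j rad).
  assert (n14 : q ^ j <> 0) by now apply Cpow_nz.
  assert (n15 : (q ^ j) ^ m <> 0) by now apply Cpow_nz.
  assert (n16 : (q ^ j) ^ (M - m) <> 0) by now apply Cpow_nz.
  assert (n17 : a ^ (j + m) <> 0) by now apply Cpow_nz.
  assert (n18 : a ^ (M - m) <> 0) by now apply Cpow_nz.
  replace (a ^ (j + M)) with (a ^ (j + m) * a ^ (M - m)) by (rewrite <- Cpow_add_r; f_equal; lia).
  replace ((q ^ j) ^ M) with ((q ^ j) ^ m * (q ^ j) ^ (M - m)) by (rewrite <- Cpow_add_r; f_equal; lia).
  rewrite Cpow_mult_l.
  assert (E1 : qpoch (/ q ^ (j + m)) q j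
               = reversal_sign q j * qpoch q q (j + m) / (qpoch q q m * (q ^ j) ^ m)).
  { rewrite <- H2. field. auto. }
  assert (E2 : qpoch (D * q ^ (j + m)) q j =
     qpoch (q ^ (j + m) * D) q (j + m) * qpoch (q ^ (2 * (j + m) + 1) * D) q (M - m)
    * (1 - D * (q ^ j * q ^ j) * q ^ (2 * m)) / qpoch (D * (q ^ j * q ^ j) * q ^ m) q (S M)).
  { rewrite H1. field. auto. }
  rewrite E1, E2. clear H1 H2 E1 E2 n4.
  field. repeat split; auto.
Qed.

(** Both families share [a], hence the same basis, so coefficients of each [aw_basis q a z z' j] can
    be compared; for fixed [j] the inner sum is [terminating_6phi5_sum]. *)
Lemma aw_connection (q a b c d g z z' : C) (N : nat) :
  q <> 0 -> a <> 0 ->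
  qregular q q -> qregular q (a * b * c * d / q) -> qregular q (c * d) ->
  qregular q (a * b) -> qregular q (a * c) -> qregular q (a * d) -> qregular q (a * g) ->
  csum (fun n => connection_coef q a b c d g N n
    * (qpoch (a * b) q n / qpoch q q n * aw_poly q a b c d z z' n)) (S N)
  = / a ^ N * qpoch (a * g) q N / (qpoch q q N * qpoch (c * d) q N)
    * aw_poly q a g c d z z' N.
Proof.
  intros q0 a0 rq rD rcd rab rac rad rag.
  rewrite (csum_ext _ (fun n => csum (fun j => connection_coef q a b c d g N n
    * (qpoch (a * b) q n / qpoch q q n * aw_coef q a b c d n j) * aw_basis q a z z' j) (S N))).
  2:{ intros n Hn. rewrite (aw_poly_extend _ _ _ _ _ _ _ n N) by (auto; lia).
      rewrite <- !csum_scal. apply csum_ext. intros; ring. }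
  rewrite csum_exchange. unfold aw_poly. rewrite <- csum_scal.
  apply csum_ext. intros j Hj.
  set (M := (N - j)%nat). assert (EN : N = (j + M)%nat) by (unfold M; lia).
  clearbody M. subst N. clear Hj.
  rewrite <- Nat.add_succ_r, csum_split, csum_zero.
  2:{ intros n Hn. rewrite aw_coef_vanish by auto. ring. }
  rewrite (csum_ext _ (fun m => / a ^ (j + M) * / (q ^ j) ^ M * reversal_sign q j
    * qpoch (a * g * c * d / q * q ^ (j + M)) q j * q ^ j
    / (qpoch (c * d) q j * qpoch q q j * qpoch (a * c) q j * qpoch (a * d) q j)
    * aw_basis q a z z' j
    * wz_term (a * q ^ j * b) (a * q ^ j * g) (c * d * q ^ j) q M m)).
  2:{ intros m Hm. rewrite connection_term by (auto; lia). ring. }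
  rewrite csum_scal, terminating_6phi5_sum; auto.
  2:{ replace (a * q ^ j * b * (c * d * q ^ j) / q) with (a * b * c * d / q * q ^ j * q ^ j)
        by (field; auto).
      do 2 apply qregular_shift; auto. }
  2:{ apply qregular_shift; auto. }
  unfold aw_coef.
  assert (H2 := qpoch_neg_power q j M q0).
  rewrite (qpoch_add (a * g)), (qpoch_add (c * d)).
  replace (a * q ^ j * g) with (a * g * q ^ j) by ring.
  assert (n4 : forall x i, qregular q x -> qpoch x q i <> 0) by (intros; apply qregular_neq0; auto).
  assert (n5 := n4 q M rq). assert (n6 := n4 q (j + M)%nat rq).
  assert (n8 := n4 q j rq).
  assert (n9 := n4 _ j rcd). assert (n10 := n4 _ M (qregular_shift _ _ j rcd)).
  assert (n11 := n4 _ j rag). assert (n12 := n4 _ j rac). assert (n13 := n4 _ j rad).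
  assert (n14 : q ^ j <> 0) by now apply Cpow_nz.
  assert (n15 : (q ^ j) ^ M <> 0) by now apply Cpow_nz.
  assert (n17 : a ^ (j + M) <> 0) by now apply Cpow_nz.
  assert (E1 : qpoch (/ q ^ (j + M)) q j
               = reversal_sign q j * qpoch q q (j + M) / (qpoch q q M * (q ^ j) ^ M)).
  { rewrite <- H2. field. auto. }
  rewrite E1. field. repeat split; auto.
Qed.

(** * Three-term recurrence *)

(** The coefficient A_n of the classical Askey-Wilson recurrence for polynomials normalized as a
    bare 4phi3; [rec_down] is its companion C_n. *)
Definition rec_up (q a b c d : C) (n : nat) : C :=
  (1 - a * b * q ^ n) * (1 - a * c * q ^ n) * (1 - a * d * q ^ n)
  * (1 - a * b * c * d / q * q ^ n)
  / (a * (1 - a * b * c * d / q * (q ^ n * q ^ n)) * (1 - a * b * c * d * (q ^ n * q ^ n))).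

(* At [n = 0] the numerator vanishes, so neither a zero denominator nor the truncated [n - 1] of
   [aw_three_term] matters. *)
Definition rec_down (q a b c d : C) (n : nat) : C :=
  a * (1 - q ^ n) * (1 - b * c * q ^ n / q) * (1 - b * d * q ^ n / q) * (1 - c * d * q ^ n / q)
  / ((1 - a * b * c * d / q * (q ^ n * q ^ n))
     * (1 - a * b * c * d / q * (q ^ n * q ^ n) / q)).

(** The part of [aw_coef] that depends on n, where D = abcd/q; a difference in n acts on nothing
    else. *)
Definition aw_num (q D : C) (n j : nat) : C := qpoch (/ q ^ n) q j * qpoch (D * q ^ n) q j.

(** Passing from n to n + 1 alters only end factors of the two symbols, so the product of the
    remaining factors comes out. *)
Lemma aw_num_diff (q D : C) n i : q <> 0 ->
  aw_num q D (S n) (S i) - aw_num q D n (S i)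
  = - (1 - q ^ S i) * (/ q ^ S n - D * q ^ n) * (qpoch (/ q ^ n) q i * qpoch (D * q ^ S n) q i).
Proof.
  intros q0. unfold aw_num.
  rewrite (qpoch_Sl (/ q ^ S n)), (qpoch_Sl (D * q ^ n)).
  assert (q ^ n <> 0) by now apply Cpow_nz.
  replace (/ q ^ S n * q) with (/ q ^ n) by (rewrite Cpow_S; field; auto).
  replace (D * q ^ n * q) with (D * q ^ S n) by (rewrite Cpow_S; ring).
  cbn [qpoch]. rewrite !Cpow_S. field. auto.
Qed.

(** The numerator factor 1 - D q^n of [rec_up] restores the symbol based at D q^n, and its
    denominator 1 - D q^(2n+1) cancels. The result is a multiple of [aw_num] at n and i; as
    [rec_down_aw_num] gives the same, the recurrence becomes an identity of rational functions. *)
Lemma rec_up_aw_num (q a b c d : C) n i :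
  q <> 0 -> a <> 0 -> qregular q (a * b * c * d / q) ->
  rec_up q a b c d n * (aw_num q (a * b * c * d / q) (S n) (S i)
                        - aw_num q (a * b * c * d / q) n (S i))
  = - (1 - a * b * q ^ n) * (1 - a * c * q ^ n) * (1 - a * d * q ^ n)
    / (a * (1 - a * b * c * d / q * (q ^ n * q ^ n))) * (1 - q ^ S i) / q ^ S n
    * (1 - a * b * c * d / q * q ^ n * q ^ i) * aw_num q (a * b * c * d / q) n i.
Proof.
  intros q0 a0 rD. rewrite aw_num_diff by auto. unfold rec_up.
  set (D := a * b * c * d / q) in *.
  assert (EQ : a * b * c * d = D * q) by (unfold D; field; auto). rewrite EQ.
  assert (E : (1 - D * q ^ n) * qpoch (D * q ^ S n) q i
              = qpoch (D * q ^ n) q i * (1 - D * q ^ n * q ^ i)).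
  { replace (D * q ^ S n) with (D * q ^ n * q) by (rewrite Cpow_S; ring).
    rewrite <- qpoch_Sl. reflexivity. }
  assert (n1 : 1 - D * (q ^ n * q ^ n) <> 0).
  { apply one_minus_neq0. rewrite <- Cpow_add_r. apply rD. }
  assert (n2 : 1 - D * q * (q ^ n * q ^ n) <> 0).
  { apply one_minus_neq0. rewrite <- Cpow_add_r, <- Cmult_assoc, <- Cpow_S. apply rD. }
  assert (n3 : q ^ n <> 0) by now apply Cpow_nz.
  unfold aw_num.
  transitivity ((1 - a * b * q ^ n) * (1 - a * c * q ^ n) * (1 - a * d * q ^ n)
    / (a * (1 - D * (q ^ n * q ^ n)) * (1 - D * q * (q ^ n * q ^ n)))
    * - (1 - q ^ S i) * (/ q ^ S n - D * q ^ n) * qpoch (/ q ^ n) q i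
    * ((1 - D * q ^ n) * qpoch (D * q ^ S n) q i)).
  - clear E. field. repeat split; auto. now apply Cpow_nz.
  - rewrite E, (Cpow_S q n). clear E EQ. field. repeat split; auto.
Qed.

Lemma rec_down_aw_num (q a b c d : C) n i :
  q <> 0 -> a <> 0 -> qregular q (a * b * c * d / q) ->
  rec_down q a b c d n * (aw_num q (a * b * c * d / q) (n - 1) (S i)
                        - aw_num q (a * b * c * d / q) n (S i))
  = - a * (1 - b * c * q ^ n / q) * (1 - b * d * q ^ n / q) * (1 - c * d * q ^ n / q)
    / (1 - a * b * c * d / q * (q ^ n * q ^ n)) * (1 - q ^ S i)
    * (1 - q ^ i / q ^ n) * aw_num q (a * b * c * d / q) n i.
Proof.
  intros q0 a0 rD. unfold rec_down.
  set (D := a * b * c * d / q) in *.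
  destruct n as [|n].
  (* At n = 0 both sides vanish: the left through 1 - q^0, the right through 1 - q^i / q^n for i = 0
     and through (1; q)_i for i > 0. *)
  - replace (1 - q ^ 0) with (RtoC 0) by (simpl; ring).
    unfold aw_num at 3. destruct i as [|i].
    + replace (1 - q ^ 0 / q ^ 0) with (RtoC 0) by (simpl; field; apply C1_nz). unfold Cdiv. ring.
    + rewrite qpoch_neg_power_vanish by (auto; lia). unfold Cdiv. ring.
  - replace (S n - 1)%nat with n by lia.
    replace (aw_num q D n (S i) - aw_num q D (S n) (S i))
      with (- (aw_num q D (S n) (S i) - aw_num q D n (S i))) by ring.
    rewrite aw_num_diff by auto.
    assert (n3 : q ^ n <> 0) by now apply Cpow_nz.
    assert (E : (1 - / q ^ S n) * qpoch (/ q ^ n) q i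
              = qpoch (/ q ^ S n) q i * (1 - / q ^ S n * q ^ i)).
    { replace (/ q ^ n) with (/ q ^ S n * q) by (rewrite Cpow_S; field; auto).
      rewrite <- qpoch_Sl. reflexivity. }
    assert (n1 : 1 - D * (q ^ S n * q ^ S n) <> 0).
    { apply one_minus_neq0. rewrite <- Cpow_add_r. apply rD. }
    assert (n2 : 1 - D * (q ^ S n * q ^ S n) / q <> 0).
    { apply one_minus_neq0. replace (D * (q ^ S n * q ^ S n) / q) with (D * (q ^ S n * q ^ n))
        by (rewrite !Cpow_S; field; auto). rewrite <- Cpow_add_r. apply rD. }
    unfold aw_num.
    transitivity (a * (1 - b * c * q ^ S n / q) * (1 - b * d * q ^ S n / q)
      * (1 - c * d * q ^ S n / q)
      / ((1 - D * (q ^ S n * q ^ S n)) * (1 - D * (q ^ S n * q ^ S n) / q))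
      * - q ^ S n * (1 - q ^ S i) * (/ q ^ S n - D * q ^ n) * qpoch (D * q ^ S n) q i
      * ((1 - / q ^ S n) * qpoch (/ q ^ n) q i)).
    + clear E. rewrite (Cpow_S q n) in *. clearbody D. field. field_side q.
    + rewrite E, (Cpow_S q n) in *. clear E. clearbody D. field. field_side q.
Qed.

Lemma aw_coef_num (q a b c d : C) n j :
  aw_coef q a b c d n j = aw_num q (a * b * c * d / q) n j * q ^ j
  / (qpoch q q j * (qpoch (a * b) q j * qpoch (a * c) q j * qpoch (a * d) q j)).
Proof. reflexivity. Qed.

Lemma aw_coef_recurrence (q a b c d : C) n i :
  q <> 0 -> a <> 0 -> qregular q q -> qregular q (a * b * c * d / q) ->
  qregular q (a * b) -> qregular q (a * c) -> qregular q (a * d) ->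
  aw_coef q a b c d n (S i) * ((/ q ^ S i - 1) * (/ a - a * q ^ S i))
  - aw_coef q a b c d n i / (a * q ^ i)
  = rec_up q a b c d n * (aw_coef q a b c d (S n) (S i) - aw_coef q a b c d n (S i))
    + rec_down q a b c d n * (aw_coef q a b c d (n - 1) (S i) - aw_coef q a b c d n (S i)).
Proof.
  intros q0 a0 rq rD rab rac rad. rewrite !aw_coef_num.
  assert (HA := rec_up_aw_num q a b c d n i q0 a0 rD).
  assert (HC := rec_down_aw_num q a b c d n i q0 a0 rD).
  set (A := rec_up q a b c d n) in *. set (B := rec_down q a b c d n) in *.
  assert (n4 : forall x i, qregular q x -> qpoch x q i <> 0) by (intros; apply qregular_neq0; auto).
  assert (n5 := n4 q (S i) rq). assert (n6 := n4 _ (S i) rab).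
  assert (n7 := n4 _ (S i) rac). assert (n8 := n4 _ (S i) rad).
  assert (n9 : q ^ i <> 0) by now apply Cpow_nz.
  set (den := qpoch q q (S i) * (qpoch (a * b) q (S i) * qpoch (a * c) q (S i) * qpoch (a * d) q (S i))).
  assert (nden : den <> 0) by (unfold den; repeat first [assumption | apply Cmult_neq_0]).
  set (D := a * b * c * d / q) in *.
  transitivity ((A * (aw_num q D (S n) (S i) - aw_num q D n (S i))
                 + B * (aw_num q D (n - 1) (S i) - aw_num q D n (S i))) * q ^ S i / den).
  2:{ field. auto. }
  rewrite HA, HC. clear HA HC.
  assert (E : aw_num q D n (S i) = aw_num q D n i * ((1 - / q ^ n * q ^ i) * (1 - D * q ^ n * q ^ i))).
  { unfold aw_num. cbn [qpoch]. ring. }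
  rewrite E. unfold den in *. clear E nden den A B.
  cbn [qpoch] in *.
  assert (m1 := n4 _ i rq). assert (m2 := n4 _ i rab). assert (m3 := n4 _ i rac).
  assert (m4 := n4 _ i rad). clear n4.
  assert (k1 : 1 - q * q ^ i <> 0) by (apply one_minus_neq0, rq).
  assert (k2 : 1 - a * b * q ^ i <> 0) by (apply one_minus_neq0, rab).
  assert (k3 : 1 - a * c * q ^ i <> 0) by (apply one_minus_neq0, rac).
  assert (k4 : 1 - a * d * q ^ i <> 0) by (apply one_minus_neq0, rad).
  assert (k5 : 1 - D * (q ^ n * q ^ n) <> 0).
  { apply one_minus_neq0. rewrite <- Cpow_add_r. apply rD. }
  assert (k6 : q ^ n <> 0) by now apply Cpow_nz.
  clear n5 n6 n7 n8.
  rewrite !Cpow_S.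
  generalize dependent (qpoch q q i). generalize dependent (qpoch (a * b) q i).
  generalize dependent (qpoch (a * c) q i). generalize dependent (qpoch (a * d) q i).
  generalize (aw_num q D n i). intros e p1 np1 p2 np2 p3 np3 p4 np4.
  unfold D in *. clear D rq rD rab rac rad.
  generalize dependent (q ^ i). generalize dependent (q ^ n). intros Q k5 nQ J nJ k1 k2 k3 k4.
  field. field_side q.
Qed.

Lemma csum_shift (f : nat -> C) n : csum (fun i => f (S i)) n = csum f (S n) - f O.
Proof. induction n as [|n IH]; simpl; [ring|]. rewrite IH. simpl. ring. Qed.

(** As z z' = 1, the new factor (1 - a z q^j) (1 - a z' q^j) is linear in z + z'; so multiplication
    by 2x - a - 1/a raises the basis index by at most one. *)
Lemma aw_basis_mul (q a z z' : C) j : q <> 0 -> a <> 0 -> z * z' = 1 ->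
  (z + z' - a - / a) * aw_basis q a z z' j
  = (/ q ^ j - 1) * (/ a - a * q ^ j) * aw_basis q a z z' j
    - / (a * q ^ j) * aw_basis q a z z' (S j).
Proof.
  intros q0 a0 Hz. unfold aw_basis. cbn [qpoch].
  assert (q ^ j <> 0) by now apply Cpow_nz.
  transitivity ((/ q ^ j - 1) * (/ a - a * q ^ j) * (qpoch (a * z) q j * qpoch (a * z') q j)
    - / (a * q ^ j) * (qpoch (a * z) q j * qpoch (a * z') q j)
      * (1 - a * q ^ j * (z + z') + a * q ^ j * (a * q ^ j) * (z * z'))).
  - rewrite Hz. field. auto.
  - ring.
Qed.

Lemma aw_three_term (q a b c d z z' : C) n :
  q <> 0 -> a <> 0 -> z * z' = 1 -> qregular q q -> qregular q (a * b * c * d / q) ->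
  qregular q (a * b) -> qregular q (a * c) -> qregular q (a * d) ->
  (z + z' - a - / a) * aw_poly q a b c d z z' n
  = rec_up q a b c d n * (aw_poly q a b c d z z' (S n) - aw_poly q a b c d z z' n)
    + rec_down q a b c d n * (aw_poly q a b c d z z' (n - 1) - aw_poly q a b c d z z' n).
Proof.
  intros q0 a0 Hz rq rD rab rac rad.
  rewrite (aw_poly_extend _ _ _ _ _ _ _ n (S n)) by (auto; lia).
  rewrite (aw_poly_extend _ _ _ _ _ _ _ (n - 1) (S n)) by (auto; lia).
  unfold aw_poly.
  rewrite <- !csum_sub, <- !csum_scal, <- csum_add.
  set (phi := aw_basis q a z z').
  (* [h j] is what the multiplication carries from index j - 1 up to j. It vanishes at j = n + 2
     because [aw_coef] stops at n, so the shifted sum has no end term. *)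
  set (h := fun j : nat => match j return C with
                     | O => 0
                     | S i => aw_coef q a b c d n i / (a * q ^ i) * phi (S i)
                     end).
  rewrite (csum_ext _ (fun j => aw_coef q a b c d n j * ((/ q ^ j - 1) * (/ a - a * q ^ j)) * phi j
                                - h (S j))).
  2:{ intros j _. unfold h.
      transitivity (aw_coef q a b c d n j * ((z + z' - a - / a) * phi j)); [ring|].
      unfold phi. rewrite aw_basis_mul by auto. unfold Cdiv. ring. }
  rewrite csum_sub, csum_shift, (csum_S h).
  assert (Hh : h (S (S n)) = 0).
  { unfold h. rewrite aw_coef_vanish by auto. unfold Cdiv. ring. }
  rewrite Hh. change (h O) with (RtoC 0).
  replace (csum h (S (S n)) + 0 - 0) with (csum h (S (S n))) by ring.
  rewrite <- csum_sub. apply csum_ext. intros j _.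
  destruct j as [|i].
  - unfold h, aw_coef. simpl. field. repeat split; auto using C1_nz.
  - unfold h.
    transitivity ((aw_coef q a b c d n (S i) * ((/ q ^ S i - 1) * (/ a - a * q ^ S i))
      - aw_coef q a b c d n i / (a * q ^ i)) * phi (S i)); [ring|].
    rewrite aw_coef_recurrence by auto. ring.
Qed.

(** * Limits and geometrically bounded series *)

(** Complex convergence through the real sequence of distances, so that squeeze arguments apply;
    [Cto_Clim] and [Cto_is_series] translate back. *)
Definition Cto (u : nat -> C) (l : C) : Prop := is_lim_seq (fun n => Cmod (u n - l)) 0%R.

Lemma Cto_le (u : nat -> C) (l : C) (e : nat -> R) :
  (forall n, (Cmod (u n - l) <= e n)%R) -> is_lim_seq e 0%R -> Cto u l.
Proof.
  intros H He. apply is_lim_seq_le_le with (fun _ => 0%R) e; auto.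
  - intros n. split; [apply Cmod_ge_0 | auto].
  - apply is_lim_seq_const.
Qed.

Lemma Cto_ext (u v : nat -> C) (l : C) : (forall n, u n = v n) -> Cto u l -> Cto v l.
Proof. intros H. apply is_lim_seq_ext. intros n. now rewrite H. Qed.

Lemma Cto_eq (u : nat -> C) (l m : C) : Cto u l -> l = m -> Cto u m.
Proof. now intros H <-. Qed.

Lemma Cto_const (l : C) : Cto (fun _ => l) l.
Proof.
  apply Cto_le with (fun _ => 0%R); [|apply is_lim_seq_const].
  intros n. replace (l - l) with (RtoC 0) by ring. rewrite Cmod_0. lra.
Qed.

Lemma Cto_plus (u v : nat -> C) (l m : C) :
  Cto u l -> Cto v m -> Cto (fun n => u n + v n) (l + m).
Proof.
  intros Hu Hv.
  apply Cto_le with (fun n => Cmod (u n - l) + Cmod (v n - m))%R.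
  - intros n. replace (u n + v n - (l + m)) with ((u n - l) + (v n - m)) by ring.
    apply Cmod_triangle.
  - replace 0%R with (0 + 0)%R by ring. now apply is_lim_seq_plus'.
Qed.

Lemma Cto_mult (u v : nat -> C) (l m : C) :
  Cto u l -> Cto v m -> Cto (fun n => u n * v n) (l * m).
Proof.
  intros Hu Hv.
  apply Cto_le with (fun n => Cmod (u n - l) * Cmod (v n - m)
    + (Cmod l * Cmod (v n - m) + Cmod m * Cmod (u n - l)))%R.
  - intros n. replace (u n * v n - l * m)
      with ((u n - l) * (v n - m) + (l * (v n - m) + m * (u n - l))) by ring.
    eapply Rle_trans; [apply Cmod_triangle|]. rewrite Cmod_mult.
    apply Rplus_le_compat_l. eapply Rle_trans; [apply Cmod_triangle|].
    rewrite !Cmod_mult. lra.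
  - replace 0%R with (0 * 0 + (Cmod l * 0 + Cmod m * 0))%R by ring.
    apply is_lim_seq_plus'; [now apply is_lim_seq_mult'|].
    apply is_lim_seq_plus'; apply is_lim_seq_mult'; auto; apply is_lim_seq_const.
Qed.

Lemma Cto_scal (k : C) (u : nat -> C) (l : C) : Cto u l -> Cto (fun n => k * u n) (k * l).
Proof. intros. apply Cto_mult; auto. apply Cto_const. Qed.

Lemma Cto_unique (u : nat -> C) (l m : C) : Cto u l -> Cto u m -> l = m.
Proof.
  intros Hu Hv.
  assert (H : Cto (fun _ => l - m) 0).
  { apply Cto_ext with (fun n => (u n + -1 * l) * -1 + (u n + - m)); [intros; ring|].
    replace (RtoC 0) with ((l + -1 * l) * -1 + (m + - m)) by ring.
    apply Cto_plus; [apply Cto_mult|]; try apply Cto_plus; auto; apply Cto_const. }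
  apply is_lim_seq_unique in H. rewrite Lim_seq_const in H.
  injection H as H. apply Cmod_eq_0 in H.
  replace l with (l - m - 0 + m) by ring. rewrite H. ring.
Qed.

Lemma Cto_incr (u : nat -> C) (l : C) : Cto u l <-> Cto (fun n => u (S n)) l.
Proof. apply (is_lim_seq_incr_1 (fun n => Cmod (u n - l))). Qed.

Lemma Cto_norm_le (u : nat -> C) (l : C) (B : R) :
  Cto u l -> (forall n, (Cmod (u n) <= B)%R) -> (Cmod l <= B)%R.
Proof.
  intros H HB. apply Rnot_lt_le. intros Hlt.
  apply is_lim_seq_spec in H.
  assert (He : (0 < Cmod l - B)%R) by lra.
  destruct (H (mkposreal _ He)) as [n Hn]. specialize (Hn n (le_n n)). simpl in Hn.
  rewrite Rminus_0_r, Rabs_pos_eq in Hn by apply Cmod_ge_0.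
  specialize (HB n).
  assert (Cmod l <= Cmod (u n) + Cmod (u n - l))%R.
  { replace l with (u n + - (u n - l)) at 1 by ring.
    eapply Rle_trans; [apply Cmod_triangle|]. rewrite Cmod_opp. lra. }
  lra.
Qed.

Lemma Cto_norm_ge (u : nat -> C) (l : C) (B : R) :
  Cto u l -> (forall n, (B <= Cmod (u n))%R) -> (B <= Cmod l)%R.
Proof.
  intros H HB. apply Rnot_lt_le. intros Hlt.
  apply is_lim_seq_spec in H.
  assert (He : (0 < B - Cmod l)%R) by lra.
  destruct (H (mkposreal _ He)) as [n Hn]. specialize (Hn n (le_n n)). simpl in Hn.
  rewrite Rminus_0_r, Rabs_pos_eq in Hn by apply Cmod_ge_0.
  specialize (HB n).
  assert (Cmod (u n) <= Cmod l + Cmod (u n - l))%R.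
  { replace (u n) with (l + (u n - l)) at 1 by ring. apply Cmod_triangle. }
  lra.
Qed.

Lemma Cto_Clim (u : nat -> C) (l : C) : Cto u l -> Clim u = l.
Proof.
  intros H. destruct l as [l1 l2]. unfold Clim.
  assert (Hc : forall (f : C -> R) (l0 : R), (forall n, (Rabs (f (u n) - l0) <= Cmod (u n - (l1, l2)))%R) ->
    real (Lim_seq (fun n => f (u n))) = l0).
  { intros f l0 Hf. rewrite (is_lim_seq_unique _ l0); auto.
    apply is_lim_seq_ext with (fun n => (f (u n) - l0) + l0)%R; [intros; ring|].
    replace (Finite l0) with (Finite (0 + l0)%R) by (f_equal; ring).
    apply is_lim_seq_plus'; [|apply is_lim_seq_const].
    apply is_lim_seq_abs_0.
    apply is_lim_seq_le_le with (fun _ => 0%R) (fun n => Cmod (u n - (l1, l2))); auto.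
    - intros n. split; [apply Rabs_pos|auto].
    - apply is_lim_seq_const. }
  f_equal.
  - apply Hc. intros n. apply (re_le_Cmod (u n - (l1, l2))).
  - apply Hc. intros n. eapply Rle_trans; [|apply Rmax_Cmod].
    apply (Rmax_r (Rabs (fst (u n - (l1, l2)))) (Rabs (snd (u n - (l1, l2))))).
Qed.

Lemma sum_n_csum (a : nat -> C) n : sum_n a n = csum a (S n).
Proof.
  induction n as [|n IH].
  - rewrite sum_O. simpl. symmetry. apply Cplus_0_l.
  - rewrite sum_Sn, IH. reflexivity.
Qed.

Lemma Cto_is_series (a : nat -> C) (l : C) : Cto (csum a) l -> is_series a l.
Proof.
  intros H. apply (proj1 (Cto_incr _ _)) in H. apply is_lim_seq_spec in H.
  apply filterlim_locally. intros eps.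
  destruct (H eps) as [N HN]. exists N. intros n Hn. specialize (HN n Hn).
  rewrite Rminus_0_r, Rabs_pos_eq in HN by apply Cmod_ge_0.
  rewrite sum_n_csum. apply C_NormedModule_mixin_compat1. exact HN.
Qed.

Lemma is_series_Cto (a : nat -> C) (l : C) : is_series a l -> Cto (csum a) l.
Proof.
  intros H. apply Cto_incr. apply is_lim_seq_spec. intros eps.
  (* Balls in C are product balls of the two components; passing from them to [Cmod] costs a factor
     sqrt 2. *)
  assert (Hs : (0 < sqrt 2)%R) by (apply sqrt_lt_R0; lra).
  assert (He : (0 < eps / sqrt 2)%R) by (apply Rdiv_lt_0_compat; [apply eps|auto]).
  destruct (proj1 (filterlim_locally _ _) H (mkposreal _ He)) as [N HN]. exists N. intros n Hn. specialize (HN n Hn).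
  rewrite Rminus_0_r, Rabs_pos_eq by apply Cmod_ge_0.
  rewrite <- sum_n_csum. apply C_NormedModule_mixin_compat2 in HN.
  simpl in HN. replace (sqrt 2 * (eps / sqrt 2))%R with (pos eps) in HN by (field; lra).
  exact HN.
Qed.

Lemma csum_Csum_inf (a : nat -> C) (l : C) : Cto (csum a) l -> Csum_inf a = l.
Proof.
  intros H. apply Cto_Clim. apply (proj1 (Cto_incr _ _)) in H.
  apply Cto_ext with (fun n => csum a (S n)); auto. intros n. now rewrite sum_n_csum.
Qed.

Lemma finite_Csum_inf (a : nat -> C) n : (forall k, (n < k)%nat -> a k = 0) ->
  Csum_inf a = csum a (S n).
Proof.
  intros H. apply csum_Csum_inf.
  apply is_lim_seq_ext_loc with (fun _ => 0%R); [|apply is_lim_seq_const].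
  exists (S n). intros k Hk. replace k with (S n + (k - S n))%nat by lia.
  rewrite csum_split, (csum_zero (fun i => a (S n + i)%nat)) by (intros; apply H; lia).
  replace (csum a (S n) + 0 - csum a (S n)) with (RtoC 0) by ring. now rewrite Cmod_0.
Qed.

Definition geo_bounded (a : nat -> C) (K r : R) : Prop := forall n, (Cmod (a n) <= K * r ^ n)%R.

Lemma csum_norm_le (a : nat -> C) (b : R) n :
  (forall i, (i < n)%nat -> (Cmod (a i) <= b)%R) -> (Cmod (csum a n) <= INR n * b)%R.
Proof.
  induction n as [|n IH]; intros H.
  - simpl. rewrite Cmod_0. lra.
  - rewrite csum_S, S_INR. eapply Rle_trans; [apply Cmod_triangle|].
    specialize (IH (fun i Hi => H i (Nat.lt_lt_succ_r _ _ Hi))).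
    specialize (H n (Nat.lt_succ_diag_r n)). lra.
Qed.

Lemma geo_csum_le (a : nat -> C) (K r : R) n :
  (0 <= r < 1)%R -> geo_bounded a K r -> (Cmod (csum a n) <= K * (1 - r ^ n) / (1 - r))%R.
Proof.
  intros Hr H. induction n as [|n IH].
  - simpl. rewrite Cmod_0. unfold Rdiv. lra.
  - rewrite csum_S. eapply Rle_trans; [apply Cmod_triangle|].
    specialize (H n).
    replace (K * (1 - r ^ S n) / (1 - r))%R with (K * (1 - r ^ n) / (1 - r) + K * r ^ n)%R
      by (simpl; field; lra).
    lra.
Qed.

Lemma geo_bound_nonneg (a : nat -> C) (K r : R) : geo_bounded a K r -> (0 <= K)%R.
Proof. intros H. specialize (H O). simpl in H. pose proof (Cmod_ge_0 (a O)). lra. Qed.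

Lemma geo_csum_bound (a : nat -> C) (K r : R) n :
  (0 <= r < 1)%R -> geo_bounded a K r -> (Cmod (csum a n) <= K / (1 - r))%R.
Proof.
  intros Hr H. eapply Rle_trans; [apply geo_csum_le; eauto|].
  assert (HK := geo_bound_nonneg _ _ _ H).
  apply Rmult_le_compat_r; [left; apply Rinv_0_lt_compat; lra|].
  assert (0 <= r ^ n)%R by (apply pow_le; lra). nra.
Qed.

Lemma geo_series (a : nat -> C) (K r : R) :
  (0 <= r < 1)%R -> geo_bounded a K r -> exists l, Cto (csum a) l.
Proof.
  intros Hr H.
  assert (He : ex_series a).
  { apply (ex_series_le (V := C_CompleteNormedModule) a (fun n => K * r ^ n)%R).
    - intros n. apply H.
    - apply (ex_series_scal_l K (fun n => r ^ n)%R). apply ex_series_geom.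
      rewrite Rabs_pos_eq; lra. }
  destruct He as [l Hl]. exists l. now apply is_series_Cto.
Qed.

Lemma geo_tail (a : nat -> C) (K r : R) (l : C) n :
  (0 <= r < 1)%R -> geo_bounded a K r -> Cto (csum a) l ->
  (Cmod (l - csum a n) <= K * r ^ n / (1 - r))%R.
Proof.
  intros Hr H Hl.
  apply Cto_norm_le with (fun m => csum a (n + m) - csum a n).
  - apply Cto_plus; [|apply Cto_const].
    apply (is_lim_seq_incr_n (fun m => Cmod (csum a m - l)) n) in Hl.
    apply Cto_ext with (fun m => csum a (m + n)); [|exact Hl].
    intros m. now rewrite Nat.add_comm.
  - intros m. rewrite csum_split.
    replace (csum a n + csum (fun i => a (n + i)%nat) m - csum a n)
      with (csum (fun i => a (n + i)%nat) m) by ring.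
    apply geo_csum_bound; auto. intros i. rewrite Rmult_assoc, <- pow_add. apply H.
Qed.

Lemma geo_lim (K r : R) : (0 <= r < 1)%R -> is_lim_seq (fun n => K * r ^ n)%R 0%R.
Proof.
  intros Hr. replace 0%R with (K * 0)%R by ring.
  apply is_lim_seq_mult'; [apply is_lim_seq_const|]. apply is_lim_seq_geom.
  rewrite Rabs_pos_eq; lra.
Qed.

Lemma Cto_geo_zero (a : nat -> C) (K r : R) : (0 <= r < 1)%R -> geo_bounded a K r -> Cto a 0.
Proof.
  intros Hr H. apply Cto_le with (fun n => K * r ^ n)%R; [|now apply geo_lim].
  intros n. replace (a n - 0) with (a n) by ring. apply H.
Qed.

(** * Infinite products *)

(** Each factor satisfies |u - v q^i| <= s (1 + |v| |q|^i / s), and 1 + y <= exp y; the exponents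
    then form a geometric series. A majorant s > 0 in place of |u| admits u = 0 and gives uniformity
    in u. *)
Lemma newton_bound (q u v : C) (s : R) n :
  (Cmod q < 1)%R -> (0 < s)%R -> (Cmod u <= s)%R ->
  (Cmod (newton u v q n) <= exp (Cmod v / s / (1 - Cmod q)) * s ^ n)%R.
Proof.
  intros Hq Hs Hu.
  assert (Hv := Cmod_ge_0 v). assert (Hq0 := Cmod_ge_0 q).
  assert (H : (Cmod (newton u v q n)
    <= exp (Cmod v / s * ((1 - Cmod q ^ n) / (1 - Cmod q))) * s ^ n)%R).
  { induction n as [|n IH].
    - simpl. rewrite Cmod_1.
      replace (Cmod v / s * ((1 - 1) / (1 - Cmod q)))%R with 0%R by (field; lra).
      rewrite exp_0. lra.
    - cbn [newton]. rewrite Cmod_mult.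
      assert (H1 : (Cmod (u - v * q ^ n) <= s * exp (Cmod v / s * Cmod q ^ n))%R).
      { apply Rle_trans with (s * (1 + Cmod v / s * Cmod q ^ n))%R.
        - replace (s * (1 + Cmod v / s * Cmod q ^ n))%R with (s + Cmod v * Cmod q ^ n)%R
            by (field; lra).
          eapply Rle_trans; [apply Cmod_triangle|].
          rewrite Cmod_opp, Cmod_mult, Cmod_pow. lra.
        - apply Rmult_le_compat_l; [lra|]. apply exp_ineq1_le. }
      replace (exp (Cmod v / s * ((1 - Cmod q ^ S n) / (1 - Cmod q))) * s ^ S n)%R
        with ((exp (Cmod v / s * ((1 - Cmod q ^ n) / (1 - Cmod q))) * s ^ n)
              * (s * exp (Cmod v / s * Cmod q ^ n)))%R.
      + apply Rmult_le_compat; auto using Cmod_ge_0.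
      + replace (Cmod v / s * ((1 - Cmod q ^ S n) / (1 - Cmod q)))%R
          with (Cmod v / s * ((1 - Cmod q ^ n) / (1 - Cmod q)) + Cmod v / s * Cmod q ^ n)%R
          by (simpl; field; lra).
        rewrite exp_plus. simpl. ring. }
  eapply Rle_trans; [apply H|].
  apply Rmult_le_compat_r; [apply pow_le; lra|].
  assert (0 <= Cmod q ^ n)%R by now apply pow_le.
  assert (0 <= Cmod v / s)%R by (apply Rdiv_le_0_compat; lra).
  assert (Hle : (Cmod v / s * ((1 - Cmod q ^ n) / (1 - Cmod q)) <= Cmod v / s / (1 - Cmod q))%R).
  { unfold Rdiv at 3. apply Rmult_le_compat_l; auto.
    rewrite <- (Rmult_1_l (/ (1 - Cmod q))) at 1.
    apply Rmult_le_compat_r; [left; apply Rinv_0_lt_compat|]; lra. }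
  destruct Hle as [Hle|Hle]; [left; now apply exp_increasing | rewrite Hle; lra].
Qed.

Lemma newton_1 (v q : C) n : newton 1 v q n = qpoch v q n.
Proof. induction n as [|n IH]; simpl; [easy|]. now rewrite IH. Qed.

Definition qpoch_majorant (y q : C) : R := exp (Cmod y / (1 - Cmod q)).

Lemma qpoch_bound (y q : C) n : (Cmod q < 1)%R -> (Cmod (qpoch y q n) <= qpoch_majorant y q)%R.
Proof.
  intros Hq. rewrite <- newton_1.
  assert (H := newton_bound q 1 y 1 n Hq ltac:(lra) ltac:(rewrite Cmod_1; lra)).
  rewrite pow1, Rmult_1_r, Rdiv_1_r in H. exact H.
Qed.

Lemma qpoch_majorant_mono (x y q : C) : (Cmod q < 1)%R -> (Cmod x <= Cmod y)%R ->
  (qpoch_majorant x q <= qpoch_majorant y q)%R.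
Proof.
  intros Hq Hxy. unfold qpoch_majorant.
  assert (H : (Cmod x / (1 - Cmod q) <= Cmod y / (1 - Cmod q))%R).
  { apply Rmult_le_compat_r; auto. left; apply Rinv_0_lt_compat; lra. }
  destruct H as [H|H]; [left; now apply exp_increasing | rewrite H; lra].
Qed.

(** Telescoping turns convergence of the infinite product into that of a series with geometrically
    decaying terms. *)
Lemma qpoch_as_csum (y q : C) n :
  qpoch y q n = 1 + csum (fun i => - qpoch y q i * y * q ^ i) n.
Proof. induction n as [|n IH]; simpl; [ring|]. rewrite IH at 1. rewrite IH. ring. Qed.

Lemma qpoch_increment_geo (x y q : C) : (Cmod q < 1)%R -> (Cmod x <= Cmod y)%R ->
  geo_bounded (fun i => - qpoch x q i * x * q ^ i) (qpoch_majorant y q * Cmod x) (Cmod q).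
Proof.
  intros Hq Hxy n. rewrite !Cmod_mult, Cmod_opp, Cmod_pow.
  apply Rmult_le_compat_r; [apply pow_le, Cmod_ge_0|].
  apply Rmult_le_compat_r; [apply Cmod_ge_0|].
  eapply Rle_trans; [now apply qpoch_bound|]. now apply qpoch_majorant_mono.
Qed.

Lemma qpoch_near_1 (x y q : C) n : (Cmod q < 1)%R -> (Cmod x <= Cmod y)%R ->
  (Cmod (qpoch x q n - 1) <= qpoch_majorant y q * Cmod x / (1 - Cmod q))%R.
Proof.
  intros Hq Hxy. rewrite qpoch_as_csum.
  replace (1 + csum (fun i => - qpoch x q i * x * q ^ i) n - 1)
    with (csum (fun i => - qpoch x q i * x * q ^ i) n) by ring.
  apply geo_csum_bound; [split; [apply Cmod_ge_0|auto]|]. now apply qpoch_increment_geo.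
Qed.

Lemma qpoch_inf_lim (y q : C) : (Cmod q < 1)%R -> Cto (qpoch y q) (qpoch_inf y q).
Proof.
  intros Hq.
  destruct (geo_series _ _ _ (conj (Cmod_ge_0 q) Hq)
    (qpoch_increment_geo y y q Hq (Rle_refl _))) as [l Hl].
  assert (H : Cto (qpoch y q) (1 + l)).
  { apply Cto_ext with (fun n => 1 + csum (fun i => - qpoch y q i * y * q ^ i) n).
    - intros n. now rewrite <- qpoch_as_csum.
    - apply Cto_plus; auto. apply Cto_const. }
  unfold qpoch_inf. now rewrite (Cto_Clim _ _ H).
Qed.

Lemma qpoch_inf_step (y q : C) : (Cmod q < 1)%R ->
  qpoch_inf y q = (1 - y) * qpoch_inf (y * q) q.
Proof.
  intros Hq. apply Cto_unique with (fun n => qpoch y q (S n)).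
  - apply (proj1 (Cto_incr _ _)). now apply qpoch_inf_lim.
  - apply Cto_ext with (fun n => (1 - y) * qpoch (y * q) q n).
    + intros n. symmetry. apply qpoch_Sl.
    + apply Cto_scal. now apply qpoch_inf_lim.
Qed.

Lemma qpoch_inf_split (y q : C) n : (Cmod q < 1)%R ->
  qpoch_inf y q = qpoch y q n * qpoch_inf (y * q ^ n) q.
Proof.
  intros Hq. induction n as [|n IH].
  - simpl. rewrite Cmult_1_r. ring.
  - rewrite IH. cbn [qpoch]. rewrite (qpoch_inf_step (y * q ^ n)) by auto.
    replace (y * q ^ n * q) with (y * q ^ S n) by (rewrite Cpow_S; ring). ring.
Qed.

Lemma qpoch_inf_bound (y q : C) : (Cmod q < 1)%R ->
  (Cmod (qpoch_inf y q) <= qpoch_majorant y q)%R.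
Proof.
  intros Hq. eapply Cto_norm_le; [now apply qpoch_inf_lim|]. intros. now apply qpoch_bound.
Qed.

Lemma Cmod_shift_le (y q : C) n : (Cmod q < 1)%R -> (Cmod (y * q ^ n) <= Cmod y)%R.
Proof.
  intros Hq. rewrite Cmod_mult, Cmod_pow.
  assert (H : (Cmod q ^ n <= 1 ^ n)%R) by (apply pow_incr; split; [apply Cmod_ge_0|lra]).
  rewrite pow1 in H. assert (H1 := Cmod_ge_0 y). nra.
Qed.

Lemma qpoch_inf_shift_bound (y q : C) n : (Cmod q < 1)%R ->
  (Cmod (qpoch_inf (y * q ^ n) q) <= qpoch_majorant y q)%R.
Proof.
  intros Hq. eapply Rle_trans; [now apply qpoch_inf_bound|].
  apply qpoch_majorant_mono; auto. now apply Cmod_shift_le.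
Qed.

Lemma qpoch_inf_to_1 (y q : C) : (Cmod q < 1)%R ->
  Cto (fun K => qpoch_inf (y * q ^ K) q) 1.
Proof.
  intros Hq.
  apply Cto_le with (fun K => qpoch_majorant y q * Cmod y / (1 - Cmod q) * Cmod q ^ K)%R.
  - intros K. apply Cto_norm_le with (fun n => qpoch (y * q ^ K) q n - 1).
    + apply Cto_plus; [now apply qpoch_inf_lim | apply Cto_const].
    + intros n. eapply Rle_trans; [apply qpoch_near_1 with (y := y)|]; auto.
      * now apply Cmod_shift_le.
      * rewrite Cmod_mult, Cmod_pow. right. field. lra.
  - apply geo_lim. split; [apply Cmod_ge_0|auto].
Qed.

Lemma qpoch_0 (q : C) n : qpoch 0 q n = 1.
Proof. induction n as [|n IH]; simpl; [easy|]. rewrite IH. ring. Qed.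

Lemma qpoch_inf_0 (q : C) : qpoch_inf 0 q = 1.
Proof.
  apply Cto_Clim. apply Cto_ext with (fun _ => RtoC 1); [|apply Cto_const].
  intros n. now rewrite qpoch_0.
Qed.

(** The Weierstrass inequality: a product of factors 1 - x_i is at least 1 minus the sum of the
    |x_i| in modulus, and that sum is at most 1/2 here. *)
Lemma qpoch_small_lower (x q : C) n : (Cmod q < 1)%R -> (Cmod x / (1 - Cmod q) <= 1 / 2)%R ->
  (1 / 2 <= Cmod (qpoch x q n))%R.
Proof.
  intros Hq Hx.
  assert (Hq0 := Cmod_ge_0 q). assert (Hx0 := Cmod_ge_0 x).
  assert (Hx1 : (Cmod x <= 1 / 2 * (1 - Cmod q))%R).
  { apply Rmult_le_reg_r with (/ (1 - Cmod q))%R; [apply Rinv_0_lt_compat; lra|].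
    replace (1 / 2 * (1 - Cmod q) * / (1 - Cmod q))%R with (1 / 2)%R by (field; lra). exact Hx. }
  assert (H : (1 - Cmod x * ((1 - Cmod q ^ n) / (1 - Cmod q)) <= Cmod (qpoch x q n))%R).
  { induction n as [|n IH].
    - simpl. rewrite Cmod_1. unfold Rdiv. rewrite Rminus_diag, Rmult_0_l. lra.
    - cbn [qpoch]. rewrite Cmod_mult.
      assert (Hp : (0 <= Cmod q ^ n <= 1)%R).
      { split; [now apply pow_le|]. rewrite <- (pow1 n). apply pow_incr; lra. }
      assert (Hf : (1 - Cmod x * Cmod q ^ n <= Cmod (1 - x * q ^ n))%R).
      { rewrite <- Cmod_1 at 1. rewrite <- Cmod_pow, <- Cmod_mult.
        assert (Ht : (Cmod 1 <= Cmod (1 - x * q ^ n) + Cmod (x * q ^ n))%R).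
        { replace (RtoC 1) with ((1 - x * q ^ n) + x * q ^ n) at 1 by ring. apply Cmod_triangle. }
        lra. }
      replace ((1 - Cmod q ^ S n) / (1 - Cmod q))%R
        with ((1 - Cmod q ^ n) / (1 - Cmod q) + Cmod q ^ n)%R by (simpl; field; lra).
      set (s := ((1 - Cmod q ^ n) / (1 - Cmod q))%R) in *.
      assert (Hs : (0 <= s)%R) by (apply Rdiv_le_0_compat; lra).
      assert (Hxq : (0 <= Cmod x * Cmod q ^ n <= 1 / 2)%R) by nra.
      assert (Hxs : (0 <= Cmod x * s)%R) by nra.
      assert (Hpos := Cmod_ge_0 (qpoch x q n)).
      apply Rle_trans with (Cmod (qpoch x q n) * (1 - Cmod x * Cmod q ^ n))%R; [|nra].
      apply Rle_trans with ((1 - Cmod x * s) * (1 - Cmod x * Cmod q ^ n))%R; [nra|].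
      apply Rmult_le_compat_r; lra. }
  assert (Hs : ((1 - Cmod q ^ n) / (1 - Cmod q) <= / (1 - Cmod q))%R).
  { rewrite <- (Rmult_1_l (/ (1 - Cmod q))).
    apply Rmult_le_compat_r; [left; apply Rinv_0_lt_compat; lra|].
    assert (0 <= Cmod q ^ n)%R by now apply pow_le. lra. }
  unfold Rdiv in Hx at 1. nra.
Qed.

(** Finitely many nonzero factors, followed by a tail whose argument y q^N is small enough for
    [qpoch_small_lower]. *)
Lemma qpoch_lower (y q : C) : (Cmod q < 1)%R -> qregular q y ->
  exists m, (0 < m)%R /\ forall n, (m <= Cmod (qpoch y q n))%R.
Proof.
  intros Hq Hy.
  assert (Hfin : forall N, exists m, (0 < m)%R /\ forall n, (n <= N)%nat -> (m <= Cmod (qpoch y q n))%R).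
  { induction N as [|N [m [Hm HN]]].
    - exists 1%R. split; [lra|]. intros n Hn. replace n with O by lia. simpl. rewrite Cmod_1. lra.
    - exists (Rmin m (Cmod (qpoch y q (S N)))). split.
      + apply Rmin_glb_lt; auto. apply Cmod_gt_0. now apply qregular_neq0.
      + intros n Hn. destruct (Nat.eq_dec n (S N)) as [->|Hne]; [apply Rmin_r|].
        eapply Rle_trans; [apply Rmin_l|]. apply HN. lia. }
  assert (Hl := geo_lim (Cmod y / (1 - Cmod q)) _ (conj (Cmod_ge_0 q) Hq)).
  apply is_lim_seq_spec in Hl. destruct (Hl (mkposreal (1 / 2) ltac:(lra))) as [N HN].
  specialize (HN N (le_n N)). simpl in HN. rewrite Rminus_0_r in HN.
  apply Rabs_def2 in HN. destruct HN as [HN _].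
  destruct (Hfin N) as [m [Hm HmN]].
  exists (m * (1 / 2))%R. split; [lra|]. intros n.
  destruct (Nat.le_gt_cases n N) as [Hn|Hn].
  - specialize (HmN n Hn). lra.
  - replace n with (N + (n - N))%nat by lia. rewrite qpoch_add, Cmod_mult.
    apply Rmult_le_compat; try lra; [apply HmN; lia|].
    apply qpoch_small_lower; auto. rewrite Cmod_mult, Cmod_pow.
    replace (Cmod y * Cmod q ^ N / (1 - Cmod q))%R with (Cmod y / (1 - Cmod q) * Cmod q ^ N)%R
      by (field; lra). lra.
Qed.

Lemma qpoch_inf_neq0 (y q : C) : (Cmod q < 1)%R -> qregular q y -> qpoch_inf y q <> 0.
Proof.
  intros Hq Hy. destruct (qpoch_lower y q Hq Hy) as [m [Hm H]].
  apply Cmod_gt_0. apply Rlt_le_trans with m; auto.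
  eapply Cto_norm_ge; eauto. now apply qpoch_inf_lim.
Qed.

Lemma small_regular (q y : C) : (Cmod q < 1)%R -> (Cmod y < 1)%R -> qregular q y.
Proof.
  intros Hq Hy k E. assert (H := Cmod_shift_le y q k Hq). rewrite E, Cmod_1 in H. lra.
Qed.

(** * Expansion of the quotient in Askey-Wilson polynomials *)

(* The factors [(a f, c f, d f; q)_oo] are multiplied out; this makes the coefficient an entire
   function of [f], which is needed at [f = g], where [|g|] may exceed 1. *)
Definition expansion_coef (q a c d g f : C) (N : nat) : C :=
  newton f g q N / a ^ N * (qpoch (a * c) q N * qpoch (a * d) q N) * qpoch_inf (a * g) q
  * (qpoch_inf (c * g * q ^ N) q * qpoch_inf (d * g * q ^ N) q
     * qpoch_inf (a * c * d * f * q ^ N) q)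
  * (1 - a * g * c * d / q * (q ^ N * q ^ N))
  / (qpoch q q N * qpoch_inf (a * g * c * d / q * q ^ N) q).

Lemma qpoch_inf_S (y q : C) n : (Cmod q < 1)%R ->
  qpoch_inf (y * q ^ n) q = (1 - y * q ^ n) * qpoch_inf (y * q ^ S n) q.
Proof.
  intros Hq. rewrite qpoch_inf_step by auto.
  replace (y * q ^ n * q) with (y * q ^ S n) by (rewrite Cpow_S; ring). reflexivity.
Qed.

Lemma rec_down_0 (q a b c d : C) : rec_down q a b c d 0 = 0.
Proof. unfold rec_down. replace (1 - q ^ 0) with (RtoC 0) by (simpl; ring). unfold Cdiv. ring. Qed.

Lemma expansion_coef_recurrence_0 (q a c d g f : C) :
  q <> 0 -> (Cmod q < 1)%R -> a <> 0 -> qregular q q -> qregular q (a * g * c * d / q) ->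
  (1 - f * a) * (1 - f / a) * expansion_coef q a c d g f 0
  + f * expansion_coef q a c d g f 0 * (rec_up q a g c d 0 + rec_down q a g c d 0)
  - f * expansion_coef q a c d g f 1 * rec_down q a g c d 1
  = (1 - a * f) * (1 - c * f) * (1 - d * f) * expansion_coef q a c d g (q * f) 0.
Proof.
  intros q0 Hq a0 rq rA. rewrite rec_down_0. unfold expansion_coef.
  set (A := a * g * c * d / q) in *.
  rewrite (qpoch_inf_S (c * g) q 0), (qpoch_inf_S (d * g) q 0), (qpoch_inf_S A q 0) by auto.
  rewrite (qpoch_inf_S (a * c * d * f) q 0) by auto.
  replace (a * c * d * (q * f) * q ^ 0) with (a * c * d * f * q ^ 1) by (simpl; ring).
  assert (nW : qpoch_inf (A * q ^ 1) q <> 0) by (apply qpoch_inf_neq0, qregular_shift; auto).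
  set (X := qpoch_inf (c * g * q ^ 1) q). set (Y := qpoch_inf (d * g * q ^ 1) q).
  set (Z := qpoch_inf (a * c * d * f * q ^ 1) q). set (U := qpoch_inf (a * g) q).
  set (W := qpoch_inf (A * q ^ 1) q) in *.
  clearbody X Y Z U W.
  unfold rec_up, rec_down. cbn [qpoch newton]. fold A.
  assert (n1 : 1 - A * q ^ 0 <> 0) by (apply one_minus_neq0, rA).
  assert (n2 : 1 - A * q ^ 1 <> 0) by (apply one_minus_neq0, rA).
  assert (n3 : 1 - A * q ^ 2 <> 0) by (apply one_minus_neq0, rA).
  assert (n4 : 1 - q * q ^ 0 <> 0) by (apply one_minus_neq0, rq).
  simpl Cpow in *. rewrite ?Cmult_1_r in *. unfold A in *. clear A rA rq Hq.
  field. field_side q.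
Qed.

(** Compares the coefficients of p_N in the functional equation for V, using 1 - 2 x f + f^2 = (1 -
    f a) (1 - f / a) - f (2 x - a - 1/a) and the transposed three-term recurrence. By [newton_shift]
    all Newton products share [newton f g q n], and the infinite products differ by finitely many
    factors, so a rational identity remains. *)
Lemma expansion_coef_recurrence_S (q a c d g f : C) n :
  q <> 0 -> (Cmod q < 1)%R -> a <> 0 -> qregular q q -> qregular q (a * g * c * d / q) ->
  (1 - f * a) * (1 - f / a) * expansion_coef q a c d g f (S n)
  + f * expansion_coef q a c d g f (S n) * (rec_up q a g c d (S n) + rec_down q a g c d (S n))
  - f * expansion_coef q a c d g f n * rec_up q a g c d n
  - f * expansion_coef q a c d g f (S (S n)) * rec_down q a g c d (S (S n))
  = (1 - a * f) * (1 - c * f) * (1 - d * f) * expansion_coef q a c d g (q * f) (S n).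
Proof.
  intros q0 Hq a0 rq rA. unfold expansion_coef.
  rewrite newton_shift.
  set (A := a * g * c * d / q) in *.
  rewrite (qpoch_inf_S (c * g) q n), (qpoch_inf_S (d * g) q n), (qpoch_inf_S A q n) by auto.
  rewrite (qpoch_inf_S (c * g) q (S n)), (qpoch_inf_S (d * g) q (S n)), (qpoch_inf_S A q (S n)) by auto.
  rewrite (qpoch_inf_S (a * c * d * f) q n), (qpoch_inf_S (a * c * d * f) q (S n)) by auto.
  replace (a * c * d * (q * f) * q ^ S n) with (a * c * d * f * q ^ S (S n))
    by (rewrite (Cpow_S q (S n)); ring).
  assert (nW : qpoch_inf (A * q ^ S (S n)) q <> 0) by (apply qpoch_inf_neq0, qregular_shift; auto).
  set (X := qpoch_inf (c * g * q ^ S (S n)) q). set (Y := qpoch_inf (d * g * q ^ S (S n)) q).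
  set (Z := qpoch_inf (a * c * d * f * q ^ S (S n)) q). set (U := qpoch_inf (a * g) q).
  set (W := qpoch_inf (A * q ^ S (S n)) q) in *.
  clearbody X Y Z U W.
  unfold rec_up, rec_down. cbn [qpoch newton]. fold A.
  assert (m1 : qpoch q q n <> 0) by (apply qregular_neq0; auto).
  assert (m2 : a ^ n <> 0) by now apply Cpow_nz.
  assert (m3 : q ^ n <> 0) by now apply Cpow_nz.
  assert (k1 : 1 - A * q ^ n <> 0) by (apply one_minus_neq0, rA).
  assert (k2 : 1 - A * q ^ S n <> 0) by (apply one_minus_neq0, rA).
  assert (k3 : 1 - q * q ^ n <> 0) by (apply one_minus_neq0, rq).
  assert (k4 : 1 - q * q ^ S n <> 0) by (apply one_minus_neq0, rq).
  assert (kk : forall i, 1 - A * q ^ (i + (n + n)) <> 0) by (intros; apply one_minus_neq0, rA).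
  assert (k5 := kk 0%nat). assert (k6 := kk 1%nat). assert (k7 := kk 2%nat).
  assert (k8 := kk 3%nat). assert (k9 := kk 4%nat). clear kk.
  rewrite !(Cpow_add_r q) in *. rewrite !Cpow_S in *. simpl (q ^ 0) in *.
  unfold A in *. clear A rA rq Hq.
  generalize dependent (qpoch q q n). generalize dependent (a ^ n). generalize dependent (q ^ n).
  generalize (qpoch (a * c) q n) (qpoch (a * d) q n) (newton f g q n).
  intros pc pd nw Q m3 k1 k2 k3 k4 k5 k6 k7 k8 k9 an m2 pq m1.
  field. field_side q.
Qed.

(** Summation by parts: the coefficient recurrences cancel everything inside, and only two boundary
    products at n and n + 1 survive. *)
Lemma expansion_partial_sum (q a c d g f z z' : C) n :
  q <> 0 -> (Cmod q < 1)%R -> a <> 0 -> z * z' = 1 -> qregular q q ->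
  qregular q (a * g * c * d / q) ->
  qregular q (a * g) -> qregular q (a * c) -> qregular q (a * d) ->
  (1 - (z + z') * f + f ^ 2)
    * csum (fun N => expansion_coef q a c d g f N * aw_poly q a g c d z z' N) (S n)
  - (1 - a * f) * (1 - c * f) * (1 - d * f)
    * csum (fun N => expansion_coef q a c d g (q * f) N * aw_poly q a g c d z z' N) (S n)
  = f * (expansion_coef q a c d g f (S n) * rec_down q a g c d (S n) * aw_poly q a g c d z z' n
         - expansion_coef q a c d g f n * rec_up q a g c d n * aw_poly q a g c d z z' (S n)).
Proof.
  intros q0 Hq a0 Hz rq rA rag rac rad.
  set (T := aw_poly q a g c d z z'). set (V := expansion_coef q a c d g).
  set (up := rec_up q a g c d). set (dn := rec_down q a g c d).
  assert (HT : forall N, (1 - (z + z') * f + f ^ 2) * T N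
    = (1 - f * a) * (1 - f / a) * T N
      - f * (up N * (T (S N) - T N) + dn N * (T (N - 1)%nat - T N))).
  { intros N. unfold T, up, dn. rewrite <- aw_three_term by auto. field. auto. }
  induction n as [|n IH].
  - simpl csum.
    transitivity (V f 0%nat * ((1 - (z + z') * f + f ^ 2) * T 0%nat)
      - (1 - a * f) * (1 - c * f) * (1 - d * f) * V (q * f) 0%nat * T 0%nat); [ring|].
    rewrite HT. unfold V at 2.
    rewrite <- expansion_coef_recurrence_0 by auto. fold V up dn.
    assert (H0 : dn 0%nat = 0) by apply rec_down_0. rewrite H0. ring.
  - rewrite (csum_S _ (S n)), (csum_S (fun N => V (q * f) N * T N) (S n)).
    transitivity (
     ((1 - (z + z') * f + f ^ 2) * csum (fun N => V f N * T N) (S n)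
      - (1 - a * f) * (1 - c * f) * (1 - d * f) * csum (fun N => V (q * f) N * T N) (S n))
     + (V f (S n) * ((1 - (z + z') * f + f ^ 2) * T (S n))
      - (1 - a * f) * (1 - c * f) * (1 - d * f) * V (q * f) (S n) * T (S n))); [ring|].
    rewrite IH, HT. unfold V at 4.
    rewrite <- expansion_coef_recurrence_S by auto. fold V up dn.
    replace (S n - 1)%nat with n by lia. ring.
Qed.

Lemma Cto_eventually (u : nat -> C) (l : C) (eps : R) : Cto u l -> (0 < eps)%R ->
  exists N, forall n, (N <= n)%nat -> (Cmod (u n - l) < eps)%R.
Proof.
  intros H He. apply is_lim_seq_spec in H.
  destruct (H (mkposreal _ He)) as [N HN]. exists N. intros n Hn. specialize (HN n Hn).
  simpl in HN. rewrite Rminus_0_r, Rabs_pos_eq in HN by apply Cmod_ge_0. exact HN.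
Qed.

Lemma Cto_inv_1 (u : nat -> C) : Cto u 1 -> Cto (fun n => / u n) 1.
Proof.
  intros H. destruct (Cto_eventually u 1 (1 / 2) H ltac:(lra)) as [N HN].
  apply is_lim_seq_incr_n with N.
  apply is_lim_seq_le_le with (fun _ => 0%R) (fun n => 2 * Cmod (u (n + N)%nat - 1))%R.
  - intros n. split; [apply Cmod_ge_0|].
    specialize (HN (n + N)%nat ltac:(lia)). set (x := u (n + N)%nat) in *.
    assert (Hx : (1 / 2 <= Cmod x)%R).
    { assert (Ht : (Cmod 1 <= Cmod x + Cmod (x - 1))%R).
      { replace (RtoC 1) with (x + - (x - 1)) at 1 by ring.
        eapply Rle_trans; [apply Cmod_triangle|]. rewrite Cmod_opp. lra. }
      rewrite Cmod_1 in Ht. lra. }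
    assert (x0 : x <> 0) by (apply Cmod_gt_0; lra).
    replace (/ x - 1) with (- (x - 1) * / x) by (field; auto).
    rewrite Cmod_mult, Cmod_opp, Cmod_inv by auto.
    rewrite (Rmult_comm 2). apply Rmult_le_compat_l; [apply Cmod_ge_0|].
    replace 2%R with (/ (1 / 2))%R by field. apply Rinv_le_contravar; lra.
  - apply is_lim_seq_const.
  - replace (Finite 0) with (Finite (2 * 0)%R) by (f_equal; ring).
    apply is_lim_seq_mult'; [apply is_lim_seq_const|].
    apply (is_lim_seq_incr_n (fun n => Cmod (u n - 1)) N). exact H.
Qed.

Lemma Cto_pow_0 (q y : C) : (Cmod q < 1)%R -> Cto (fun n => y * q ^ n) 0.
Proof.
  intros Hq. apply Cto_geo_zero with (Cmod y) (Cmod q); [split; [apply Cmod_ge_0|auto]|].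
  intros n. rewrite Cmod_mult, Cmod_pow. lra.
Qed.

Lemma Cto_one_minus (u : nat -> C) : Cto u 0 -> Cto (fun n => 1 - u n) 1.
Proof.
  intros H. replace (RtoC 1) with (1 + -1 * 0) by ring.
  apply Cto_ext with (fun n => 1 + -1 * u n); [intros; ring|].
  apply Cto_plus; [apply Cto_const | now apply Cto_scal].
Qed.

Lemma Cto_mult_1 (u v : nat -> C) : Cto u 1 -> Cto v 1 -> Cto (fun n => u n * v n) 1.
Proof. intros. replace (RtoC 1) with (1 * 1) by ring. now apply Cto_mult. Qed.

Lemma Cto_pow2_0 (q y : C) : (Cmod q < 1)%R -> Cto (fun n => y * (q ^ n * q ^ n)) 0.
Proof.
  intros Hq. apply Cto_ext with (fun n => (y * q ^ n) * (1 * q ^ n)); [intros; ring|].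
  replace (RtoC 0) with (0 * 0) by ring. apply Cto_mult; now apply Cto_pow_0.
Qed.

(** * Growth of the polynomials for |z| = 1 *)

(** With [rec_down_lim], this shows that r n = p_n / a^n satisfies a recurrence tending to r (n + 2)
    = (z + z') r (n + 1) - r n. *)
Lemma rec_up_lim (q a b c d : C) :
  q <> 0 -> (Cmod q < 1)%R -> a <> 0 -> qregular q (a * b * c * d / q) ->
  Cto (fun n => a * rec_up q a b c d n) 1.
Proof.
  intros q0 Hq a0 rD.
  apply Cto_ext with (fun n =>
    (1 - a * b * q ^ n) * (1 - a * c * q ^ n) * (1 - a * d * q ^ n)
    * (1 - a * b * c * d / q * q ^ n)
    * (/ (1 - a * b * c * d / q * (q ^ n * q ^ n)) * / (1 - a * b * c * d * (q ^ n * q ^ n)))).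
  { intros n. unfold rec_up.
    assert (n1 : 1 - a * b * c * d / q * (q ^ n * q ^ n) <> 0).
    { apply one_minus_neq0. rewrite <- Cpow_add_r. apply rD. }
    assert (n2 : 1 - a * b * c * d * (q ^ n * q ^ n) <> 0).
    { apply one_minus_neq0.
      replace (a * b * c * d * (q ^ n * q ^ n)) with (a * b * c * d / q * (q ^ S n * q ^ n))
        by (rewrite Cpow_S; field; auto).
      rewrite <- Cpow_add_r. apply rD. }
    field. field_side q. }
  repeat apply Cto_mult_1; try (apply Cto_one_minus; now apply Cto_pow_0);
    apply Cto_inv_1, Cto_one_minus; now apply Cto_pow2_0.
Qed.

Lemma rec_down_lim (q a b c d : C) :
  q <> 0 -> (Cmod q < 1)%R -> a <> 0 -> qregular q (a * b * c * d / q) ->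
  Cto (fun n => rec_down q a b c d n / a) 1.
Proof.
  intros q0 Hq a0 rD. apply Cto_incr.
  apply Cto_ext with (fun n =>
    (1 - q * q ^ n) * (1 - b * c * q ^ n) * (1 - b * d * q ^ n) * (1 - c * d * q ^ n)
    * (/ (1 - a * b * c * d / q * q * q * (q ^ n * q ^ n))
       * / (1 - a * b * c * d / q * q * (q ^ n * q ^ n)))).
  { intros n. unfold rec_down.
    set (D := a * b * c * d / q) in *.
    assert (n1 : 1 - D * q * q * (q ^ n * q ^ n) <> 0).
    { apply one_minus_neq0.
      replace (D * q * q * (q ^ n * q ^ n)) with (D * (q ^ S n * q ^ S n)) by (rewrite Cpow_S; ring).
      rewrite <- Cpow_add_r. apply rD. }
    assert (n2 : 1 - D * q * (q ^ n * q ^ n) <> 0).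
    { apply one_minus_neq0.
      replace (D * q * (q ^ n * q ^ n)) with (D * (q ^ S n * q ^ n)) by (rewrite Cpow_S; ring).
      rewrite <- Cpow_add_r. apply rD. }
    clearbody D. rewrite !Cpow_S. field. field_side q. }
  repeat apply Cto_mult_1; try (apply Cto_one_minus; now apply Cto_pow_0);
    apply Cto_inv_1, Cto_one_minus; now apply Cto_pow2_0.
Qed.

Lemma geo_bounded_eventually (u : nat -> C) (K r : R) N : (0 < r)%R ->
  (forall n, (N <= n)%nat -> (Cmod (u n) <= K * r ^ n)%R) -> exists K', geo_bounded u K' r.
Proof.
  intros Hr. revert K. induction N as [|N IH]; intros K H.
  - exists K. intros n. apply H. lia.
  - apply (IH (Rmax K (Cmod (u N) / r ^ N))). intros n Hn.
    assert (Hp : (0 < r ^ n)%R) by now apply pow_lt.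
    destruct (Nat.eq_dec n N) as [->|Hne].
    + apply Rle_trans with (Cmod (u N) / r ^ N * r ^ N)%R; [right; field; lra|].
      apply Rmult_le_compat_r; [lra | apply Rmax_r].
    + eapply Rle_trans; [apply H; lia|]. apply Rmult_le_compat_r; [lra | apply Rmax_l].
Qed.

Lemma geo_bounded_shift (u : nat -> C) (K r : R) N : (0 < r)%R ->
  geo_bounded (fun n => u (N + n)%nat) K r -> exists K', geo_bounded u K' r.
Proof.
  intros Hr H. apply geo_bounded_eventually with (K / r ^ N)%R N; auto.
  intros n Hn. replace n with (N + (n - N))%nat by lia.
  rewrite pow_add. assert (0 < r ^ N)%R by now apply pow_lt.
  replace (K / r ^ N * (r ^ N * r ^ (n - N)))%R with (K * r ^ (n - N))%R by (field; lra).
  apply H.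
Qed.

(* With [s = r (n + 1) - z * r n] the limiting recurrence is [s (n + 1) = z' * s n]; a large
   multiple of [|s|] added to [|r|] absorbs the linear growth, the rest is a perturbation. *)
Lemma perturbed_recurrence_bound (p s r : nat -> C) (z z' : C) (rho : R) :
  z * z' = 1 -> Cmod z = 1%R -> Cto p (z + z') -> Cto s 1 -> (1 < rho <= 3)%R ->
  (forall n, r (S (S n)) = p n * r (S n) - s n * r n) ->
  exists K, geo_bounded r K rho.
Proof.
  intros Hz Mz Hp Hs Hrho Hr.
  assert (Mz' : Cmod z' = 1%R).
  { assert (H : Cmod (z * z') = 1%R) by (rewrite Hz; apply Cmod_1).
    rewrite Cmod_mult, Mz in H. lra. }
  (* With weight k on |t|, one step costs 1 + k + k eta on |t| and 1 + 2 k eta on |r|. Taking k eta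
     = (rho - 1) / 2 makes the latter rho, and k (rho - 1) = 2 makes the former at most rho k
     exactly when rho <= 3. *)
  set (eta := ((rho - 1) * (rho - 1) / 4)%R).
  assert (Heta : (0 < eta)%R) by (unfold eta; nra).
  destruct (Cto_eventually _ _ _ Hp Heta) as [N1 HN1].
  destruct (Cto_eventually _ _ _ Hs Heta) as [N2 HN2].
  set (N := (N1 + N2)%nat).
  set (k := (2 / (rho - 1))%R).
  assert (Hk : (k * (rho - 1) = 2)%R) by (unfold k; field; lra).
  assert (Hk0 : (0 < k)%R) by (unfold k; apply Rdiv_lt_0_compat; lra).
  assert (Hke : (k * eta = (rho - 1) / 2)%R) by (unfold eta, k; field; lra).
  set (t := fun n => r (S n) - z * r n).
  assert (Hstep : forall n, (N <= n)%nat ->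
    (Cmod (r (S n)) + k * Cmod (t (S n)) <= rho * (Cmod (r n) + k * Cmod (t n)))%R).
  { intros n Hn. specialize (HN1 n ltac:(lia)). specialize (HN2 n ltac:(lia)).
    assert (H1 : (Cmod (r (S n)) <= Cmod (r n) + Cmod (t n))%R).
    { replace (r (S n)) with (z * r n + t n) at 1 by (unfold t; ring).
      eapply Rle_trans; [apply Cmod_triangle|]. rewrite Cmod_mult, Mz. lra. }
    assert (H2 : (Cmod (t (S n)) <= Cmod (t n) + eta * (Cmod (r (S n)) + Cmod (r n)))%R).
    { replace (t (S n)) with (z' * t n + ((p n - (z + z')) * r (S n) + - ((s n - 1) * r n))).
      2:{ unfold t. rewrite Hr.
          transitivity (p n * r (S n) - s n * r n - z * r (S n) + (1 - z * z') * r n); [ring|].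
          rewrite Hz. ring. }
      eapply Rle_trans; [apply Cmod_triangle|]. rewrite Cmod_mult, Mz', Rmult_1_l.
      apply Rplus_le_compat_l. eapply Rle_trans; [apply Cmod_triangle|].
      rewrite Cmod_opp, !Cmod_mult.
      assert (A1 := Cmod_ge_0 (r n)). assert (A2 := Cmod_ge_0 (r (S n))). nra. }
    assert (A1 := Cmod_ge_0 (r n)). assert (A2 := Cmod_ge_0 (t n)).
    assert (H3 : (Cmod (t (S n)) <= Cmod (t n) + eta * (2 * Cmod (r n) + Cmod (t n)))%R) by nra.
    assert (H4 : (k * Cmod (t (S n))
      <= k * Cmod (t n) + (rho - 1) / 2 * (2 * Cmod (r n) + Cmod (t n)))%R).
    { rewrite <- Hke. nra. }
    assert (H5 : (k * (rho - 1) * Cmod (t n) = 2 * Cmod (t n))%R) by (rewrite Hk; ring).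
    nra. }
  apply geo_bounded_shift with (Cmod (r N) + k * Cmod (t N))%R N; [lra|].
  intros n.
  assert (H : (Cmod (r (N + n)%nat) + k * Cmod (t (N + n)%nat)
               <= (Cmod (r N) + k * Cmod (t N)) * rho ^ n)%R).
  { induction n as [|n IH].
    - rewrite Nat.add_0_r. simpl. lra.
    - rewrite Nat.add_succ_r. eapply Rle_trans; [apply Hstep; lia|]. simpl. nra. }
  assert (A2 := Cmod_ge_0 (t (N + n)%nat)). nra.
Qed.

Lemma aw_poly_bound (q a b c d z z' : C) (rho : R) :
  q <> 0 -> (Cmod q < 1)%R -> a <> 0 -> z * z' = 1 -> Cmod z = 1%R -> (1 < rho <= 3)%R ->
  qregular q q -> qregular q (a * b * c * d / q) ->
  qregular q (a * b) -> qregular q (a * c) -> qregular q (a * d) ->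
  exists K, geo_bounded (aw_poly q a b c d z z') K (rho * Cmod a).
Proof.
  intros q0 Hq a0 Hz Mz Hrho rq rD rab rac rad.
  set (T := aw_poly q a b c d z z').
  set (up := rec_up q a b c d). set (dn := rec_down q a b c d).
  assert (Hup : Cto (fun n => a * up n) 1) by now apply rec_up_lim.
  assert (Hdn : Cto (fun n => dn n / a) 1) by now apply rec_down_lim.
  assert (Ma : (0 < Cmod a)%R) by now apply Cmod_gt_0.
  (* From N on [up] is nonzero, so the recurrence can be solved for the term of highest index. *)
  destruct (Cto_eventually _ _ (1 / 2) Hup ltac:(lra)) as [N HN].
  assert (nup : forall n, (N <= n)%nat -> up n <> 0).
  { intros n Hn E. specialize (HN n Hn). rewrite E in HN.
    replace (a * 0 - 1) with (- (1)) in HN by ring. rewrite Cmod_opp, Cmod_1 in HN. lra. }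
  assert (Hup' : Cto (fun n => a * up (S (n + N))) 1).
  { apply (proj1 (Cto_incr (fun n => a * up (n + N)%nat) _)).
    apply (is_lim_seq_incr_n (fun n => Cmod (a * up n - 1)) N). exact Hup. }
  assert (Hdn' : Cto (fun n => dn (S (n + N)) / a) 1).
  { apply (proj1 (Cto_incr (fun n => dn (n + N)%nat / a) _)).
    apply (is_lim_seq_incr_n (fun n => Cmod (dn n / a - 1)) N). exact Hdn. }
  set (r := fun n => T (N + n)%nat / a ^ (N + n)).
  assert (Hr : exists K, geo_bounded r K rho).
  (* [p] is the exact coefficient (z + z' - a - 1/a + up + dn) / (a up), arranged so that its limit
     z + z' is visible. *)
  { apply perturbed_recurrence_bound with
      (p := fun n => ((z + z') + (/ a * (a * up (S (n + N)) - 1) + a * (dn (S (n + N)) / a - 1)))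
                      * / (a * up (S (n + N))))
      (s := fun n => dn (S (n + N)) / a * / (a * up (S (n + N)))) (z := z) (z' := z'); auto.
    - apply Cto_eq with (((z + z') + (/ a * (1 + -(1)) + a * (1 + -(1)))) * 1); [|ring].
      apply Cto_mult; [|now apply Cto_inv_1].
      apply Cto_plus; [apply Cto_const|].
      apply Cto_plus; apply Cto_scal; apply Cto_plus; auto; apply Cto_const.
    - apply Cto_mult_1; auto. now apply Cto_inv_1.
    - intros n. unfold r. replace (N + S (S n))%nat with (S (S (n + N))) by lia.
      replace (N + S n)%nat with (S (n + N)) by lia. replace (N + n)%nat with (n + N)%nat by lia.
      set (m := (n + N)%nat) in *.
      assert (H3 := aw_three_term q a b c d z z' (S m) q0 a0 Hz rq rD rab rac rad).
      replace (S m - 1)%nat with m in H3 by lia. fold T up dn in H3.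
      assert (u0 : up (S m) <> 0) by (apply nup; unfold m; lia).
      assert (am : a ^ m <> 0) by now apply Cpow_nz.
      assert (E : T (S (S m)) = ((z + z' - a - / a) * T (S m) - dn (S m) * (T m - T (S m)))
                                / up (S m) + T (S m)).
      { rewrite H3. field. auto. }
      rewrite E, !Cpow_S. field. repeat split; auto. }
  destruct Hr as [K HK].
  assert (H : exists K', geo_bounded (fun n => T n / a ^ n) K' rho).
  { apply geo_bounded_shift with K N; [lra|]. exact HK. }
  destruct H as [K' HK']. exists K'. intros n. specialize (HK' n). simpl in HK'.
  rewrite Cmod_div, Cmod_pow in HK' by now apply Cpow_nz.
  assert (Hp : (0 < Cmod a ^ n)%R) by now apply pow_lt.
  rewrite Rpow_mult_distr.
  replace (Cmod (T n)) with (Cmod (T n) / Cmod a ^ n * Cmod a ^ n)%R by (field; lra).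
  rewrite <- Rmult_assoc. apply Rmult_le_compat_r; lra.
Qed.

(** * Uniform bounds for the coefficients *)

(** [D] carries side conditions such as |f| <= s; closure under sums and products lets long
    coefficient formulas be bounded factor by factor. *)
Definition bounded_on {X : Type} (D : X -> Prop) (u : X -> C) : Prop :=
  exists B, forall x, D x -> (Cmod (u x) <= B)%R.

Lemma bounded_const {X : Type} (D : X -> Prop) (k : C) : bounded_on D (fun _ => k).
Proof. exists (Cmod k). intros. lra. Qed.

Lemma bounded_mult {X : Type} (D : X -> Prop) (u v : X -> C) :
  bounded_on D u -> bounded_on D v -> bounded_on D (fun x => u x * v x).
Proof.
  intros [B HB] [B' HB']. exists (B * B')%R. intros x Hx. rewrite Cmod_mult.
  apply Rmult_le_compat; auto using Cmod_ge_0.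
Qed.

Lemma bounded_plus {X : Type} (D : X -> Prop) (u v : X -> C) :
  bounded_on D u -> bounded_on D v -> bounded_on D (fun x => u x + v x).
Proof.
  intros [B HB] [B' HB']. exists (B + B')%R. intros x Hx.
  eapply Rle_trans; [apply Cmod_triangle|]. specialize (HB x Hx). specialize (HB' x Hx). lra.
Qed.

Lemma bounded_qpoch {X : Type} (D : X -> Prop) (q y : C) (idx : X -> nat) :
  (Cmod q < 1)%R -> bounded_on D (fun x => qpoch y q (idx x)).
Proof. intros Hq. exists (qpoch_majorant y q). intros. now apply qpoch_bound. Qed.

Lemma bounded_inv_qpoch {X : Type} (D : X -> Prop) (q y : C) (idx : X -> nat) :
  (Cmod q < 1)%R -> qregular q y -> bounded_on D (fun x => / qpoch y q (idx x)).
Proof.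
  intros Hq Hy. destruct (qpoch_lower y q Hq Hy) as [m [Hm H]].
  exists (/ m)%R. intros x _. rewrite Cmod_inv by now apply qregular_neq0.
  apply Rinv_le_contravar; auto.
Qed.

Lemma bounded_qpoch_inf {X : Type} (D : X -> Prop) (q y : C) (idx : X -> nat) :
  (Cmod q < 1)%R -> bounded_on D (fun x => qpoch_inf (y * q ^ idx x) q).
Proof. intros Hq. exists (qpoch_majorant y q). intros. now apply qpoch_inf_shift_bound. Qed.

(** 1 / (y q^i; q)_oo = (y; q)_i / (y; q)_oo, with a bounded numerator and a constant
    denominator. *)
Lemma bounded_inv_qpoch_inf {X : Type} (D : X -> Prop) (q y : C) (idx : X -> nat) :
  (Cmod q < 1)%R -> qregular q y -> bounded_on D (fun x => / qpoch_inf (y * q ^ idx x) q).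
Proof.
  intros Hq Hy. destruct (qpoch_lower y q Hq Hy) as [m [Hm H]].
  destruct (bounded_mult D (fun _ => / qpoch_inf y q) (fun x => qpoch y q (idx x))) as [B HB].
  - apply bounded_const.
  - now apply bounded_qpoch.
  - exists B. intros x Hx. specialize (HB x Hx).
    assert (n1 := qpoch_inf_neq0 y q Hq Hy).
    assert (n2 : qpoch_inf (y * q ^ idx x) q <> 0) by (apply qpoch_inf_neq0, qregular_shift; auto).
    assert (n3 : qpoch y q (idx x) <> 0) by now apply qregular_neq0.
    replace (/ qpoch_inf (y * q ^ idx x) q) with (/ qpoch_inf y q * qpoch y q (idx x)); auto.
    rewrite (qpoch_inf_split y q (idx x)) by auto. field. auto.
Qed.

Lemma bounded_pow {X : Type} (D : X -> Prop) (q : C) (idx : X -> nat) :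
  (Cmod q < 1)%R -> bounded_on D (fun x => q ^ idx x).
Proof.
  intros Hq. exists 1%R. intros x _. rewrite <- (Cmult_1_l (q ^ idx x)).
  rewrite <- Cmod_1 at 2. now apply Cmod_shift_le.
Qed.

(** The rate comes from the Newton product and a^(-N); all other factors are bounded. One K serves
    every |f| <= s, as the limit along u q^k requires. *)
Lemma expansion_coef_bound (q a c d g : C) (s : R) :
  (Cmod q < 1)%R -> a <> 0 -> (0 < s)%R -> qregular q q -> qregular q (a * g * c * d / q) ->
  exists K, forall f, (Cmod f <= s)%R ->
    geo_bounded (expansion_coef q a c d g f) K (s / Cmod a).
Proof.
  intros Hq a0 Hs rq rA. set (A := a * g * c * d / q) in *.
  set (D := fun x : nat * C => (Cmod (snd x) <= s)%R).
  assert (Hb : bounded_on D (fun x =>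
     (qpoch (a * c) q (fst x) * qpoch (a * d) q (fst x)) * qpoch_inf (a * g) q
     * (qpoch_inf (c * g * q ^ fst x) q * qpoch_inf (d * g * q ^ fst x) q
        * qpoch_inf (a * c * d * snd x * q ^ fst x) q)
     * (1 + -A * (q ^ fst x * q ^ fst x))
     * / qpoch q q (fst x) * / qpoch_inf (A * q ^ fst x) q)).
  { repeat apply bounded_mult; auto using bounded_const, bounded_qpoch, bounded_inv_qpoch,
      bounded_qpoch_inf, bounded_inv_qpoch_inf.
    - exists (qpoch_majorant (a * c * d * s) q). intros x Hx.
      eapply Rle_trans; [now apply qpoch_inf_shift_bound|].
      apply qpoch_majorant_mono; auto. rewrite !(Cmod_mult (a * c * d)).
      apply Rmult_le_compat_l; [apply Cmod_ge_0|].
      rewrite Cmod_R, Rabs_pos_eq by lra. exact Hx.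
    - apply bounded_plus; [apply bounded_const|].
      repeat apply bounded_mult; auto using bounded_const, bounded_pow. }
  destruct Hb as [B HB].
  assert (Ma : (0 < Cmod a)%R) by now apply Cmod_gt_0.
  exists (exp (Cmod g / s / (1 - Cmod q)) * B)%R. intros f Hf N.
  specialize (HB (N, f) Hf). simpl in HB.
  assert (Hn := newton_bound q f g s N Hq Hs Hf).
  unfold expansion_coef. fold A.
  match type of HB with (Cmod ?e <= _)%R => set (R := e) in * end.
  match goal with |- (Cmod ?e <= _)%R => replace e with (newton f g q N * / a ^ N * R) end.
  2:{ unfold R, Cdiv, Cminus.
      assert (n1 : qpoch_inf (A * q ^ N) q <> 0) by (apply qpoch_inf_neq0, qregular_shift; auto).
      assert (n2 : qpoch q q N <> 0) by (now apply qregular_neq0).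
      assert (n3 : a ^ N <> 0) by now apply Cpow_nz.
      field. auto. }
  rewrite !Cmod_mult, Cmod_inv, Cmod_pow by now apply Cpow_nz.
  replace ((s / Cmod a) ^ N)%R with (s ^ N * / Cmod a ^ N)%R.
  2:{ unfold Rdiv. rewrite Rpow_mult_distr, pow_inv. reflexivity. }
  replace (exp (Cmod g / s / (1 - Cmod q)) * B * (s ^ N * / Cmod a ^ N))%R
    with (exp (Cmod g / s / (1 - Cmod q)) * s ^ N * / Cmod a ^ N * B)%R by ring.
  assert (Hi : (0 < / Cmod a ^ N)%R) by (apply Rinv_0_lt_compat, pow_lt; auto).
  apply Rmult_le_compat; auto using Cmod_ge_0.
  - apply Rmult_le_pos; [apply Cmod_ge_0 | lra].
  - apply Rmult_le_compat_r; lra.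
Qed.

Lemma Cto_csum (F : nat -> nat -> C) (L : nat -> C) n :
  (forall N, Cto (fun k => F k N) (L N)) -> Cto (fun k => csum (F k) n) (csum L n).
Proof.
  intros H. induction n as [|n IH]; [exact (Cto_const 0)|].
  apply (Cto_plus (fun k => csum (F k) n) (fun k => F k n)); auto.
Qed.

(** Dominated convergence for series. The majorant is demanded only from [k0] on, since the points u
    q^k enter the disc of the uniform bound only eventually. *)
Lemma tannery (F : nat -> nat -> C) (L S : nat -> C) (l : C) (B r : R) (k0 : nat) :
  (0 <= r < 1)%R -> (forall k, (k0 <= k)%nat -> geo_bounded (F k) B r) -> geo_bounded L B r ->
  (forall N, Cto (fun k => F k N) (L N)) ->
  (forall k, Cto (csum (F k)) (S k)) -> Cto (csum L) l -> Cto S l.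
Proof.
  intros Hr HF HL Hlim HS Hl.
  apply is_lim_seq_spec. intros eps.
  assert (Hg := geo_lim (B / (1 - r)) r Hr). apply is_lim_seq_spec in Hg.
  assert (He : (0 < eps / 3)%R) by (assert (H := cond_pos eps); lra).
  destruct (Hg (mkposreal _ He)) as [M HM]. specialize (HM M (le_n M)). simpl in HM.
  rewrite Rminus_0_r in HM. apply Rabs_def2 in HM. destruct HM as [HM _].
  replace (B / (1 - r) * r ^ M)%R with (B * r ^ M / (1 - r))%R in HM by (field; lra).
  destruct (Cto_eventually _ _ _ (Cto_csum F L M Hlim) He) as [k1 Hk1].
  exists (k0 + k1)%nat. intros k Hk. specialize (Hk1 k ltac:(lia)).
  rewrite Rminus_0_r, Rabs_pos_eq by apply Cmod_ge_0.
  assert (H1 := geo_tail _ _ _ _ M Hr (HF k ltac:(lia)) (HS k)).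
  assert (H2 := geo_tail _ _ _ _ M Hr HL Hl).
  replace (S k - l) with ((S k - csum (F k) M) + ((csum (F k) M - csum L M) + - (l - csum L M)))
    by ring.
  eapply Rle_lt_trans; [apply Cmod_triangle|].
  eapply Rle_lt_trans; [apply Rplus_le_compat_l, Cmod_triangle|].
  rewrite Cmod_opp. lra.
Qed.

Lemma newton_terminates (q g : C) k N : (k < N)%nat -> newton (g * q ^ k) g q N = 0.
Proof.
  induction N as [|N IH]; intros H; [lia|]. cbn [newton].
  destruct (Nat.eq_dec k N) as [->|Hne].
  - ring.
  - rewrite IH by lia. ring.
Qed.

Lemma Cto_newton (q g u : C) N : (Cmod q < 1)%R ->
  Cto (fun k => newton (u * q ^ k) g q N) (newton 0 g q N).
Proof.
  intros Hq. induction N as [|N IH]; [exact (Cto_const 1)|].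
  cbn [newton]. apply Cto_mult; auto. unfold Cminus.
  apply Cto_plus; [now apply Cto_pow_0 | apply Cto_const].
Qed.

Lemma Cto_expansion_coef (q a c d g u : C) N : (Cmod q < 1)%R ->
  Cto (fun k => expansion_coef q a c d g (u * q ^ k) N) (expansion_coef q a c d g 0 N).
Proof.
  intros Hq. unfold expansion_coef, Cdiv.
  repeat apply Cto_mult; try apply Cto_const; [now apply Cto_newton|].
  replace (a * c * d * 0 * q ^ N) with (RtoC 0) by ring. rewrite qpoch_inf_0.
  apply Cto_ext with (fun k => qpoch_inf (a * c * d * u * q ^ N * q ^ k) q).
  - intros k. f_equal. ring.
  - now apply qpoch_inf_to_1.
Qed.


(** The limit of [expansion_partial_sum]: the coefficients are O((s / |a|)^n), the polynomials
    O((rho |a|)^n), and s rho < 1 removes the boundary terms. *)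
Lemma expansion_sum_step (q a c d g f z z' S1 S2 : C) (K K' s rho : R) :
  q <> 0 -> (Cmod q < 1)%R -> a <> 0 -> z * z' = 1 -> qregular q q ->
  qregular q (a * g * c * d / q) ->
  qregular q (a * g) -> qregular q (a * c) -> qregular q (a * d) ->
  (0 < s)%R -> (0 < rho)%R -> (s * rho < 1)%R ->
  geo_bounded (expansion_coef q a c d g f) K (s / Cmod a) ->
  geo_bounded (aw_poly q a g c d z z') K' (rho * Cmod a) ->
  Cto (csum (fun N => expansion_coef q a c d g f N * aw_poly q a g c d z z' N)) S1 ->
  Cto (csum (fun N => expansion_coef q a c d g (q * f) N * aw_poly q a g c d z z' N)) S2 ->
  (1 - f * z) * (1 - f * z') * S1 = (1 - a * f) * (1 - c * f) * (1 - d * f) * S2.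
Proof.
  intros q0 Hq a0 Hz rq rA rag rac rad Hs Hrho Hsr HV HT H1 H2.
  assert (Ma : (0 < Cmod a)%R) by now apply Cmod_gt_0.
  assert (Hsr0 : (0 < s * rho)%R) by now apply Rmult_lt_0_compat.
  set (T := aw_poly q a g c d z z') in *. set (V := expansion_coef q a c d g) in *.
  assert (HK := geo_bound_nonneg _ _ _ HV). assert (HK' := geo_bound_nonneg _ _ _ HT).
  assert (Hsa : (0 < s / Cmod a)%R) by now apply Rdiv_lt_0_compat.
  assert (Hra : (0 < rho * Cmod a)%R) by now apply Rmult_lt_0_compat.
  assert (Hpow : forall n, ((s / Cmod a) ^ n * (rho * Cmod a) ^ n = (s * rho) ^ n)%R).
  { intros n. rewrite <- Rpow_mult_distr. f_equal. field. lra. }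
  assert (B1 : Cto (fun n => V f (S n) * T n) 0).
  { apply Cto_geo_zero with (K * K' * (s / Cmod a))%R (s * rho)%R; [lra|].
    intros n. rewrite Cmod_mult, <- Hpow.
    replace (K * K' * (s / Cmod a) * ((s / Cmod a) ^ n * (rho * Cmod a) ^ n))%R
      with (K * (s / Cmod a) ^ S n * (K' * (rho * Cmod a) ^ n))%R by (simpl; ring).
    apply Rmult_le_compat; auto using Cmod_ge_0. }
  assert (B2 : Cto (fun n => V f n * T (S n)) 0).
  { apply Cto_geo_zero with (K * K' * (rho * Cmod a))%R (s * rho)%R; [lra|].
    intros n. rewrite Cmod_mult, <- Hpow.
    replace (K * K' * (rho * Cmod a) * ((s / Cmod a) ^ n * (rho * Cmod a) ^ n))%R
      with (K * (s / Cmod a) ^ n * (K' * (rho * Cmod a) ^ S n))%R by (simpl; ring).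
    apply Rmult_le_compat; auto using Cmod_ge_0. }
  assert (U := rec_up_lim q a g c d q0 Hq a0 rA).
  assert (D := rec_down_lim q a g c d q0 Hq a0 rA). apply (proj1 (Cto_incr _ _)) in D.
  apply Cto_unique with (fun n => (1 - (z + z') * f + f ^ 2) * csum (fun N => V f N * T N) (S n)).
  - replace ((1 - f * z) * (1 - f * z')) with (1 - (z + z') * f + f ^ 2).
    2:{ transitivity (1 - (z + z') * f + f ^ 2 * (z * z')); [rewrite Hz|]; ring. }
    apply Cto_scal. now apply (proj1 (Cto_incr _ _)).
  - apply Cto_ext with (fun n => (1 - a * f) * (1 - c * f) * (1 - d * f)
        * csum (fun N => V (q * f) N * T N) (S n)
      + f * (a * ((rec_down q a g c d (S n) / a) * (V f (S n) * T n))
             + -1 * (/ a * ((a * rec_up q a g c d n) * (V f n * T (S n)))))).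
    + intros n.
      assert (E := expansion_partial_sum q a c d g f z z' n q0 Hq a0 Hz rq rA rag rac rad).
      fold V T in E.
      match type of E with ?x - ?y = ?w => transitivity (y + w); [|rewrite <- E; ring] end.
      field. auto.
    + apply Cto_eq with ((1 - a * f) * (1 - c * f) * (1 - d * f) * S2
        + f * (a * (1 * 0) + -1 * (/ a * (1 * 0)))); [|ring].
      apply Cto_plus.
      * apply Cto_scal. now apply (proj1 (Cto_incr _ _)).
      * apply Cto_scal, Cto_plus.
        -- apply Cto_scal, Cto_mult; auto.
        -- apply Cto_scal, Cto_scal, Cto_mult; auto.
Qed.

(** Iterates [expansion_sum_step] along u, u q, u q^2, ...: the accumulated factors tend to infinite
    products, the sums to the value at 0. Besides the uniform bound near 0 there is an individual
    bound at each point, so that u = g is covered even when |g| >= 1. *)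
Lemma expansion_sum_at_geometric_points (q a c d g u z z' S0 : C) (S : nat -> C)
    (K K' s rho : R) :
  q <> 0 -> (Cmod q < 1)%R -> a <> 0 -> z * z' = 1 -> qregular q q ->
  qregular q (a * g * c * d / q) ->
  qregular q (a * g) -> qregular q (a * c) -> qregular q (a * d) ->
  (0 < s)%R -> (0 < rho)%R -> (s * rho < 1)%R ->
  (forall f, (Cmod f <= s)%R -> geo_bounded (expansion_coef q a c d g f) K (s / Cmod a)) ->
  (forall k, exists K0, geo_bounded (expansion_coef q a c d g (u * q ^ k)) K0 (s / Cmod a)) ->
  geo_bounded (aw_poly q a g c d z z') K' (rho * Cmod a) ->
  (forall k, Cto (csum (fun N => expansion_coef q a c d g (u * q ^ k) N
                                 * aw_poly q a g c d z z' N)) (S k)) ->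
  Cto (csum (fun N => expansion_coef q a c d g 0 N * aw_poly q a g c d z z' N)) S0 ->
  qpoch_inf (u * z) q * qpoch_inf (u * z') q * S O
  = qpoch_inf (a * u) q * qpoch_inf (c * u) q * qpoch_inf (d * u) q * S0.
Proof.
  intros q0 Hq a0 Hz rq rA rag rac rad Hs Hrho Hsr HV HVu HT HS HS0.
  assert (Ma : (0 < Cmod a)%R) by now apply Cmod_gt_0.
  set (T := aw_poly q a g c d z z') in *. set (V := expansion_coef q a c d g) in *.
  assert (Hind : forall k, qpoch (u * z) q k * qpoch (u * z') q k * S O
    = qpoch (a * u) q k * qpoch (c * u) q k * qpoch (d * u) q k * S k).
  { induction k as [|k IH]; [simpl; ring|]. cbn [qpoch].
    destruct (HVu k) as [K0 HK0].
    assert (Hstep := expansion_sum_step q a c d g (u * q ^ k) z z' (S k) (S (Datatypes.S k))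
      K0 K' s rho q0 Hq a0 Hz rq rA rag rac rad Hs Hrho Hsr HK0 HT (HS k)).
    replace (q * (u * q ^ k)) with (u * q ^ Datatypes.S k) in Hstep by (rewrite Cpow_S; ring).
    specialize (Hstep (HS (Datatypes.S k))).
    transitivity ((1 - u * q ^ k * z) * (1 - u * q ^ k * z')
      * (qpoch (u * z) q k * qpoch (u * z') q k * S O)); [ring|].
    rewrite IH.
    transitivity (qpoch (a * u) q k * qpoch (c * u) q k * qpoch (d * u) q k
      * ((1 - u * q ^ k * z) * (1 - u * q ^ k * z') * S k)); [ring|].
    rewrite Hstep. ring. }
  assert (HK := geo_bound_nonneg _ _ _ HT).
  assert (Hprod : forall f, (Cmod f <= s)%R -> geo_bounded (fun N => V f N * T N) (K * K') (s * rho)).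
  { intros f Hf n. rewrite Cmod_mult.
    replace (K * K' * (s * rho) ^ n)%R with (K * (s / Cmod a) ^ n * (K' * (rho * Cmod a) ^ n))%R.
    - apply Rmult_le_compat; auto using Cmod_ge_0. now apply HV.
    - replace (s * rho)%R with (s / Cmod a * (rho * Cmod a))%R by (field; lra).
      rewrite (Rpow_mult_distr (s / Cmod a)). ring. }
  assert (Hlim : Cto S S0).
  { destruct (Cto_eventually _ _ _ (Cto_pow_0 q u Hq) Hs) as [k0' Hk0'].
    apply tannery with (F := fun k N => V (u * q ^ k) N * T N) (L := fun N => V 0 N * T N)
      (B := (K * K')%R) (r := (s * rho)%R) (k0 := k0'); auto.
    - split; [left; now apply Rmult_lt_0_compat | auto].
    - intros k Hk. apply Hprod. specialize (Hk0' k Hk).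
      replace (u * q ^ k) with (u * q ^ k - 0) by ring. lra.
    - apply Hprod. rewrite Cmod_0. lra.
    - intros N. apply Cto_mult; [now apply Cto_expansion_coef | apply Cto_const]. }
  apply Cto_unique with (fun k => qpoch (u * z) q k * qpoch (u * z') q k * S O).
  - repeat apply Cto_mult; auto using qpoch_inf_lim, Cto_const.
  - apply Cto_ext with (fun k => qpoch (a * u) q k * qpoch (c * u) q k * qpoch (d * u) q k * S k).
    + intros k. now rewrite Hind.
    + repeat apply Cto_mult; auto using qpoch_inf_lim, Cto_const.
Qed.

Lemma ratio_expansion (q a c d g t z z' : C) :
  q <> 0 -> (Cmod q < 1)%R -> a <> 0 -> z * z' = 1 -> Cmod z = 1%R -> (Cmod t < 1)%R ->
  qregular q q -> qregular q (a * g * c * d / q) ->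
  qregular q (a * g) -> qregular q (c * g) -> qregular q (d * g) ->
  qregular q (a * c) -> qregular q (a * d) ->
  Cto (csum (fun N => expansion_coef q a c d g t N * aw_poly q a g c d z z' N))
    (qpoch_inf (a * t) q * qpoch_inf (c * t) q * qpoch_inf (d * t) q
     * (qpoch_inf (g * z) q * qpoch_inf (g * z') q
        / (qpoch_inf (t * z) q * qpoch_inf (t * z') q))).
Proof.
  intros q0 Hq a0 Hz Mz Ht rq rA rag rcg rdg rac rad.
  assert (Ma : (0 < Cmod a)%R) by now apply Cmod_gt_0.
  assert (Mz' : Cmod z' = 1%R).
  { assert (H : Cmod (z * z') = 1%R) by (rewrite Hz; apply Cmod_1).
    rewrite Cmod_mult, Mz in H. lra. }
  assert (Ht0 := Cmod_ge_0 t).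
  (* s lies between |t| and 1, rho between 1 and 1 / s, and s rho = (1 + s) / 2 < 1; s >= 1/2 keeps
     rho below 3. *)
  set (s := ((1 + Cmod t) / 2)%R).
  assert (Hs : (1 / 2 <= s < 1)%R) by (unfold s; lra).
  assert (Hts : (Cmod t <= s)%R) by (unfold s; lra).
  set (rho := ((1 + / s) / 2)%R).
  assert (His : (1 < / s <= 2)%R).
  { split.
    - rewrite <- Rinv_1. apply Rinv_lt_contravar; lra.
    - replace 2%R with (/ (1 / 2))%R by field. apply Rinv_le_contravar; lra. }
  assert (Hrho : (1 < rho <= 3)%R) by (unfold rho; lra).
  assert (Hsr : (s * rho < 1)%R).
  { unfold rho. replace (s * ((1 + / s) / 2))%R with ((s + 1) / 2)%R by (field; lra). lra. }
  set (T := aw_poly q a g c d z z'). set (V := expansion_coef q a c d g).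
  destruct (aw_poly_bound q a g c d z z' rho q0 Hq a0 Hz Mz Hrho rq rA rag rac rad) as [K' HT].
  destruct (expansion_coef_bound q a c d g s Hq a0 ltac:(lra) rq rA) as [K HV].
  fold T in HT. fold V in HV.
  assert (Hex : forall f, (exists K0, geo_bounded (V f) K0 (s / Cmod a)) ->
    exists S, Cto (csum (fun N => V f N * T N)) S).
  { intros f [K0 HK0].
    assert (HKT := geo_bound_nonneg _ _ _ HT).
    apply geo_series with (K0 * K')%R (s * rho)%R.
    - split; [|auto]. left. apply Rmult_lt_0_compat; lra.
    - intros n. rewrite Cmod_mult.
      replace (K0 * K' * (s * rho) ^ n)%R
        with (K0 * (s / Cmod a) ^ n * (K' * (rho * Cmod a) ^ n))%R.
      + apply Rmult_le_compat; auto using Cmod_ge_0.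
      + replace (s * rho)%R with (s / Cmod a * (rho * Cmod a))%R by (field; lra).
        rewrite (Rpow_mult_distr (s / Cmod a)). ring. }
  assert (Hsmall : forall f, (Cmod f <= s)%R -> exists K0, geo_bounded (V f) K0 (s / Cmod a))
    by (intros f Hf; exists K; auto).
  assert (Hseq : forall u, (forall k, exists K0, geo_bounded (V (u * q ^ k)) K0 (s / Cmod a)) ->
    forall S0, Cto (csum (fun N => V 0 N * T N)) S0 ->
    exists S1, Cto (csum (fun N => V u N * T N)) S1 /\
      qpoch_inf (u * z) q * qpoch_inf (u * z') q * S1
      = qpoch_inf (a * u) q * qpoch_inf (c * u) q * qpoch_inf (d * u) q * S0).
  { intros u Hu S0 HS0.
    set (S := fun k => Clim (csum (fun N => V (u * q ^ k) N * T N))).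
    assert (HS : forall k, Cto (csum (fun N => V (u * q ^ k) N * T N)) (S k)).
    { intros k. destruct (Hex _ (Hu k)) as [l Hl]. unfold S. now rewrite (Cto_Clim _ _ Hl). }
    exists (S O). split.
    - specialize (HS O). simpl (q ^ 0) in HS. now rewrite Cmult_1_r in HS.
    - apply (expansion_sum_at_geometric_points q a c d g u z z' S0 S K K' s rho); auto; lra. }
  destruct (Hex 0 (Hsmall 0 ltac:(rewrite Cmod_0; lra))) as [S0 HS0].
  assert (ES0 : S0 = qpoch_inf (g * z) q * qpoch_inf (g * z') q).
  { destruct (Hseq g) with (S0 := S0) as [Sg [HSg Eg]]; auto.
    (* At g q^k the coefficients vanish from index k + 1 on, where the constant 0 serves as a
       bound. *)
    { intros k.
      destruct (geo_bounded_eventually (V (g * q ^ k)) 0 (s / Cmod a) (S k)) as [K0 HK0];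
        [apply Rdiv_lt_0_compat; lra| |now exists K0].
      intros n Hn. unfold V, expansion_coef. rewrite newton_terminates by lia.
      unfold Cdiv. rewrite !Cmult_0_l, Cmod_0. lra. }
    (* At t = g only the term N = 0 remains; there acdg = A q, so (acdg; q)_oo (1 - A) cancels (A;
       q)_oo. *)
    assert (E : Sg = qpoch_inf (a * g) q * qpoch_inf (c * g) q * qpoch_inf (d * g) q).
    { apply Cto_unique with (csum (fun N => V g N * T N)); auto.
      apply Cto_incr. eapply Cto_ext; [|apply Cto_const].
      intros n. symmetry. replace (S n) with (1 + n)%nat by lia.
      rewrite csum_split, (csum_zero (fun i => V g (1 + i)%nat * T (1 + i)%nat)).
      2:{ intros i _. unfold V, expansion_coef.
          replace g with (g * q ^ 0) at 1 by (simpl; ring).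
          rewrite newton_terminates by lia. unfold Cdiv. ring. }
      assert (nA : qpoch_inf (a * g * c * d / q) q <> 0) by now apply qpoch_inf_neq0.
      unfold V, T, expansion_coef, aw_poly, aw_coef, aw_basis.
      set (A := a * g * c * d / q) in *.
      simpl. rewrite !Cmult_1_r.
      replace (a * c * d * g) with (A * q) by (unfold A; field; auto).
      assert (EA := qpoch_inf_step A q Hq).
      rewrite EA in *.
      assert (nA1 : 1 - A <> 0) by (intros E; apply nA; rewrite E; ring).
      assert (nA2 : qpoch_inf (A * q) q <> 0) by (intros E; apply nA; rewrite E; ring).
      field. repeat split; auto using C1_nz. }
    rewrite E in Eg.
    apply Cmult_cancel_l with (qpoch_inf (a * g) q * qpoch_inf (c * g) q * qpoch_inf (d * g) q).
    - repeat apply Cmult_neq_0; now apply qpoch_inf_neq0.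
    - rewrite <- Eg. ring. }
  destruct (Hseq t) with (S0 := S0) as [St [HSt Et]]; auto.
  { intros k. apply Hsmall. eapply Rle_trans; [now apply Cmod_shift_le|]. auto. }
  apply Cto_eq with St; auto.
  assert (n1 : qpoch_inf (t * z) q <> 0).
  { apply qpoch_inf_neq0, small_regular; auto. rewrite Cmod_mult, Mz. lra. }
  assert (n2 : qpoch_inf (t * z') q <> 0).
  { apply qpoch_inf_neq0, small_regular; auto. rewrite Cmod_mult, Mz'. lra. }
  apply Cmult_cancel_l with (qpoch_inf (t * z) q * qpoch_inf (t * z') q).
  - now apply Cmult_neq_0.
  - rewrite Et, ES0. field. auto.
Qed.

(** * The double series *)

Lemma csum_triangle (w : nat -> nat -> C) M :
  csum (fun N => csum (fun n => w n (N - n)%nat) (S N)) M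
  = csum (fun n => csum (w n) (M - n)) M.
Proof.
  induction M as [|M IH]; [reflexivity|].
  rewrite csum_S, IH, !csum_S.
  rewrite (csum_ext (fun n => csum (w n) (S M - n)) (fun n => csum (w n) (M - n) + w n (M - n)%nat)).
  2:{ intros i Hi. replace (S M - i)%nat with (S (M - i)) by lia. apply csum_S. }
  rewrite csum_add. replace (S M - M)%nat with 1%nat by lia. rewrite Nat.sub_diag. simpl. ring.
Qed.

(** n x^n is at most 1 + x + ... + x^(n-1), each of whose n terms is at least x^n. *)
Lemma linear_geo_le (x : R) n : (0 <= x < 1)%R -> (INR n * x ^ n <= / (1 - x))%R.
Proof.
  intros Hx.
  assert (H : (INR n * x ^ n <= (1 - x ^ n) / (1 - x))%R).
  { induction n as [|n IH].
    - simpl. replace ((1 - 1) / (1 - x))%R with 0%R by (field; lra). lra.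
    - rewrite S_INR.
      apply Rle_trans with (x * ((1 - x ^ n) / (1 - x)) + x ^ S n)%R.
      + assert (IHx := Rmult_le_compat_l x _ _ (proj1 Hx) IH).
        replace ((INR n + 1) * x ^ S n)%R with (x * (INR n * x ^ n) + x ^ S n)%R by (simpl; ring).
        now apply Rplus_le_compat_r.
      + apply Rmult_le_reg_r with (1 - x)%R; [lra|].
        replace ((x * ((1 - x ^ n) / (1 - x)) + x ^ S n) * (1 - x))%R
          with (x * (1 - x ^ n) + x ^ S n * (1 - x))%R by (field; lra).
        replace ((1 - x ^ S n) / (1 - x) * (1 - x))%R with (1 - x ^ S n)%R by (field; lra).
        simpl. assert (Hp : (0 <= x ^ n <= 1)%R).
        { split; [apply pow_le; lra|]. rewrite <- (pow1 n). apply pow_incr; lra. }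
        assert (Hxp : (0 <= (1 - x) * (1 - x * x ^ n))%R) by (apply Rmult_le_pos; nra).
        lra. }
  eapply Rle_trans; [apply H|].
  rewrite <- (Rmult_1_l (/ (1 - x))). unfold Rdiv.
  apply Rmult_le_compat_r; [left; apply Rinv_0_lt_compat; lra|].
  assert (0 <= x ^ n)%R by (apply pow_le; lra). lra.
Qed.

Lemma linear_geo_lim (K r : R) : (0 <= K)%R -> (0 <= r < 1)%R ->
  is_lim_seq (fun n => INR n * (K * r ^ n))%R 0%R.
Proof.
  intros HK Hr. set (x := sqrt r).
  assert (Hx : (0 <= x < 1)%R).
  { split; [apply sqrt_pos|]. rewrite <- sqrt_1. apply sqrt_lt_1; lra. }
  assert (Er : r = (x * x)%R) by (symmetry; apply sqrt_sqrt; lra).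
  apply is_lim_seq_le_le with (fun _ => 0%R) (fun n => K / (1 - x) * x ^ n)%R.
  - intros n. assert (Hp : (0 <= x ^ n)%R) by (apply pow_le; lra).
    assert (Hi := pos_INR n). assert (H := linear_geo_le x n Hx).
    rewrite Er, Rpow_mult_distr. split.
    + apply Rmult_le_pos; auto. apply Rmult_le_pos; auto. now apply Rmult_le_pos.
    + replace (INR n * (K * (x ^ n * x ^ n)))%R with (K * (INR n * x ^ n) * x ^ n)%R by ring.
      apply Rmult_le_compat_r; auto. unfold Rdiv. now apply Rmult_le_compat_l.
  - apply is_lim_seq_const.
  - now apply geo_lim.
Qed.

(** The triangle n + k < M misses a tail of each row n < M, of size at most K r^n r^(M-n) / (1 - r)
    = K r^M / (1 - r). There are M such tails, and M r^M tends to 0. *)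
Lemma series_by_diagonals (w : nat -> nat -> C) (D : nat -> C) (K r : R) (l : C) :
  (0 <= r < 1)%R -> (forall n k, (Cmod (w n k) <= K * r ^ (n + k))%R) ->
  (forall n, Cto (csum (w n)) (D n)) ->
  Cto (csum (fun N => csum (fun n => w n (N - n)%nat) (S N))) l ->
  Cto (csum D) l.
Proof.
  intros Hr Hw HD Hl.
  assert (HK : (0 <= K)%R).
  { specialize (Hw O O). simpl in Hw. assert (H := Cmod_ge_0 (w O O)). lra. }
  apply Cto_ext with (fun M => csum (fun N => csum (fun n => w n (N - n)%nat) (S N)) M
                              + csum (fun n => D n - csum (w n) (M - n)) M).
  { intros M. rewrite csum_triangle, csum_sub. ring. }
  apply Cto_eq with (l + 0); [|ring]. apply Cto_plus; auto.
  apply Cto_le with (fun M => INR M * (K / (1 - r) * r ^ M))%R.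
  - intros M. replace (csum (fun n => D n - csum (w n) (M - n)) M - 0)
      with (csum (fun n => D n - csum (w n) (M - n)) M) by ring.
    apply csum_norm_le. intros n Hn.
    assert (Hg : geo_bounded (w n) (K * r ^ n) r).
    { intros k. rewrite Rmult_assoc, <- pow_add. apply Hw. }
    eapply Rle_trans; [apply (geo_tail (w n) (K * r ^ n) r (D n) (M - n) Hr Hg (HD n))|].
    rewrite Rmult_assoc, <- pow_add. replace (n + (M - n))%nat with M by lia.
    right. field. lra.
  - apply linear_geo_lim; auto. apply Rdiv_le_0_compat; lra.
Qed.

(* [double_coef n k] is the [k]-th term of the 8phi7 in [d_n], times the prefactor of [d_n] and
   [(a t, c t, d t; q)_oo]; most of its factors depend on [N = n + k] only. *)
Definition diagonal_weight (q a c d g t : C) (N : nat) : C :=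
  newton t g q N * (qpoch (a * c) q N * qpoch (a * d) q N * qpoch (c * d) q N)
  * (qpoch_inf (a * g * q ^ N) q * qpoch_inf (c * g * q ^ N) q * qpoch_inf (d * g * q ^ N) q
     * qpoch_inf (a * c * d * t * q ^ N) q)
  * (1 - a * g * c * d / q * (q ^ N * q ^ N)) / qpoch_inf (a * g * c * d / q * q ^ N) q.

Definition double_coef (q a b c d g t : C) (n k : nat) : C :=
  diagonal_weight q a c d g t (n + k) * connection_coef q a b c d g (n + k) n.

Definition double_term (q a b c d g t z z' : C) (n k : nat) : C :=
  double_coef q a b c d g t n k
  * (qpoch (a * b) q n / qpoch q q n * aw_poly q a b c d z z' n).

(** For fixed N = n + k the weight comes out and [aw_connection] sums the rest; its factor (ag; q)_N
    completes (a g q^N; q)_oo to the constant (ag; q)_oo. *)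
Lemma double_term_diagonal (q a b c d g t z z' : C) N :
  q <> 0 -> (Cmod q < 1)%R -> a <> 0 ->
  qregular q q -> qregular q (a * b * c * d / q) -> qregular q (a * g * c * d / q) ->
  qregular q (c * d) ->
  qregular q (a * b) -> qregular q (a * c) -> qregular q (a * d) -> qregular q (a * g) ->
  csum (fun n => double_term q a b c d g t z z' n (N - n)) (S N)
  = expansion_coef q a c d g t N * aw_poly q a g c d z z' N.
Proof.
  intros q0 Hq a0 rq rD rA rcd rab rac rad rag.
  rewrite (csum_ext _ (fun n => diagonal_weight q a c d g t N * (connection_coef q a b c d g N n
    * (qpoch (a * b) q n / qpoch q q n * aw_poly q a b c d z z' n)))).
  2:{ intros n Hn. unfold double_term, double_coef. replace (n + (N - n))%nat with N by lia. ring. }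
  rewrite csum_scal, aw_connection by auto.
  unfold diagonal_weight, expansion_coef.
  rewrite (qpoch_inf_split (a * g) q N) by auto.
  assert (n1 : qpoch_inf (a * g * c * d / q * q ^ N) q <> 0)
    by (apply qpoch_inf_neq0, qregular_shift; auto).
  assert (n2 : qpoch q q N <> 0) by now apply qregular_neq0.
  assert (n3 : qpoch (c * d) q N <> 0) by now apply qregular_neq0.
  assert (n4 : a ^ N <> 0) by now apply Cpow_nz.
  set (A := a * g * c * d / q) in *.
  field. auto.
Qed.

(** Trades a base moving with m for a quotient over the fixed base D, so that [bounded_inv_qpoch]
    applies. *)
Lemma qpoch_shift_ratio (q D : C) m n : qregular q D ->
  / qpoch (q ^ m * D) q n = qpoch D q m * / qpoch D q (m + n).
Proof.
  intros rD. rewrite qpoch_add, (Cmult_comm (q ^ m)).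
  assert (qpoch D q m <> 0) by now apply qregular_neq0.
  assert (qpoch (D * q ^ m) q n <> 0) by (apply qregular_neq0, qregular_shift; auto).
  field. auto.
Qed.

(** Three factors carry exponential rates: s^(n+k) from the Newton product in t, |b|^k from the one
    in b, and rho^n from a^(-n) p_n. As |b| <= 1 < rho, together they are at most (s rho)^(n+k). *)
Lemma double_term_bound (q a b c d g t z z' : C) :
  q <> 0 -> (Cmod q < 1)%R -> a <> 0 -> b <> 0 -> (Cmod b <= 1)%R ->
  z * z' = 1 -> Cmod z = 1%R -> (Cmod t < 1)%R ->
  qregular q q -> qregular q (a * b * c * d / q) -> qregular q (a * g * c * d / q) ->
  qregular q (c * d) ->
  qregular q (a * b) -> qregular q (a * c) -> qregular q (a * d) ->
  exists K r, (0 <= r < 1)%R /\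
    forall n k, (Cmod (double_term q a b c d g t z z' n k) <= K * r ^ (n + k))%R.
Proof.
  intros q0 Hq a0 b0 Mb Hz Mz Ht rq rD rA rcd rab rac rad.
  assert (Ma : (0 < Cmod a)%R) by now apply Cmod_gt_0.
  assert (Mb0 : (0 < Cmod b)%R) by now apply Cmod_gt_0.
  assert (Ht0 := Cmod_ge_0 t).
  set (s := ((1 + Cmod t) / 2)%R).
  assert (Hs : (1 / 2 <= s < 1)%R) by (unfold s; lra).
  assert (Hts : (Cmod t <= s)%R) by (unfold s; lra).
  set (rho := ((1 + / s) / 2)%R).
  assert (His : (1 < / s <= 2)%R).
  { split.
    - rewrite <- Rinv_1. apply Rinv_lt_contravar; lra.
    - replace 2%R with (/ (1 / 2))%R by field. apply Rinv_le_contravar; lra. }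
  assert (Hrho : (1 < rho <= 3)%R) by (unfold rho; lra).
  assert (Hsr : (s * rho < 1)%R).
  { unfold rho. replace (s * ((1 + / s) / 2))%R with ((s + 1) / 2)%R by (field; lra). lra. }
  destruct (aw_poly_bound q a b c d z z' rho q0 Hq a0 Hz Mz Hrho rq rD rab rac rad) as [K1 HT].
  set (D := a * b * c * d / q) in *. set (A := a * g * c * d / q) in *.
  assert (Hb : bounded_on (fun _ : nat * nat => True) (fun x => let n := fst x in let k := snd x in
     (qpoch (a * c) q (n + k) * qpoch (a * d) q (n + k) * qpoch (c * d) q (n + k))
     * (qpoch_inf (a * g * q ^ (n + k)) q * qpoch_inf (c * g * q ^ (n + k)) q
        * qpoch_inf (d * g * q ^ (n + k)) q * qpoch_inf (a * c * d * t * q ^ (n + k)) q)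
     * (1 + -A * (q ^ (n + k) * q ^ (n + k))) * / qpoch_inf (A * q ^ (n + k + n)) q
     * / qpoch q q k * (qpoch D q n * / qpoch D q (n + n))
     * (qpoch D q (2 * n + 1) * / qpoch D q (2 * n + 1 + k)) * / qpoch (c * d) q n
     * qpoch (a * b) q n * / qpoch q q n)).
  { cbv zeta.
    repeat apply bounded_mult;
      try (apply bounded_qpoch; auto); try (apply bounded_inv_qpoch; auto);
      try (apply bounded_qpoch_inf; auto); try (apply bounded_inv_qpoch_inf; auto).
    apply bounded_plus; [apply bounded_const|].
    repeat apply bounded_mult; try apply bounded_const; apply bounded_pow; auto. }
  destruct Hb as [B HB].
  set (E1 := exp (Cmod g / s / (1 - Cmod q))). set (E2 := exp (Cmod g / Cmod b / (1 - Cmod q))).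
  exists (E1 * E2 * B * K1)%R, (s * rho)%R. split; [split; [left; apply Rmult_lt_0_compat; lra|auto]|].
  intros n k. specialize (HB (n, k) I). simpl fst in HB. simpl snd in HB. cbv zeta in HB.
  match type of HB with (Cmod ?e <= _)%R => set (R := e) in * end.
  assert (H1 := newton_bound q t g s (n + k) Hq ltac:(lra) Hts). fold E1 in H1.
  assert (H2 := newton_bound q b g (Cmod b) k Hq Mb0 (Rle_refl _)). fold E2 in H2.
  specialize (HT n). set (T := aw_poly q a b c d z z' n) in *.
  replace (double_term q a b c d g t z z' n k)
    with (newton t g q (n + k) * newton b g q k * R * (/ a ^ n * T)).
  2:{ unfold double_term, double_coef, diagonal_weight, connection_coef, R. fold D A T.
      replace (n + k - n)%nat with k by lia.
      rewrite <- (qpoch_shift_ratio q D n n) by auto.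
      rewrite <- (qpoch_shift_ratio q D (2 * n + 1) k) by auto.
      assert (n1 : qpoch q q n <> 0) by now apply qregular_neq0.
      assert (n2 : qpoch q q k <> 0) by now apply qregular_neq0.
      assert (n3 : qpoch (c * d) q n <> 0) by now apply qregular_neq0.
      assert (n4 : a ^ n <> 0) by now apply Cpow_nz.
      assert (n5 : qpoch (q ^ n * D) q n <> 0).
      { rewrite Cmult_comm. apply qregular_neq0, qregular_shift; auto. }
      assert (n6 : qpoch (q ^ (2 * n + 1) * D) q k <> 0).
      { rewrite Cmult_comm. apply qregular_neq0, qregular_shift; auto. }
      assert (n7 : qpoch_inf (A * q ^ (n + k + n)) q <> 0)
        by (apply qpoch_inf_neq0, qregular_shift; auto).
      assert (n8 : qpoch (A * q ^ (n + k)) q n <> 0)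
        by (apply qregular_neq0, qregular_shift; auto).
      rewrite (qpoch_inf_split (A * q ^ (n + k)) q n) by auto.
      replace (A * q ^ (n + k) * q ^ n) with (A * q ^ (n + k + n))
        by (rewrite (Cpow_add_r q (n + k) n); ring).
      clearbody A D T.
      field. repeat split; auto. }
  rewrite !Cmod_mult, Cmod_inv, Cmod_pow by now apply Cpow_nz.
  assert (Hsk : (s ^ (n + k) * Cmod b ^ k * rho ^ n <= (s * rho) ^ (n + k))%R).
  { rewrite Rpow_mult_distr, Rmult_assoc. apply Rmult_le_compat_l; [apply pow_le; lra|].
    rewrite pow_add, Rmult_comm. apply Rmult_le_compat_l; [apply pow_le; lra|].
    apply pow_incr. lra. }
  assert (HTn : (/ Cmod a ^ n * Cmod T <= K1 * rho ^ n)%R).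
  { assert (Hp : (0 < Cmod a ^ n)%R) by now apply pow_lt.
    apply Rmult_le_reg_l with (Cmod a ^ n)%R; auto.
    rewrite <- Rmult_assoc, Rinv_r, Rmult_1_l by lra.
    rewrite Rpow_mult_distr in HT. lra. }
  assert (P1 := Cmod_ge_0 (newton t g q (n + k))). assert (P2 := Cmod_ge_0 (newton b g q k)).
  assert (P3 := Cmod_ge_0 R).
  assert (P4 : (0 <= / Cmod a ^ n * Cmod T)%R).
  { apply Rmult_le_pos; [left; apply Rinv_0_lt_compat, pow_lt; auto | apply Cmod_ge_0]. }
  apply Rle_trans with ((E1 * s ^ (n + k)) * (E2 * Cmod b ^ k) * B * (K1 * rho ^ n))%R.
  - apply Rmult_le_compat; auto.
    + apply Rmult_le_pos; auto. now apply Rmult_le_pos.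
    + apply Rmult_le_compat; auto; [now apply Rmult_le_pos|].
      apply Rmult_le_compat; auto.
  - replace (E1 * s ^ (n + k) * (E2 * Cmod b ^ k) * B * (K1 * rho ^ n))%R
      with (E1 * E2 * B * K1 * (s ^ (n + k) * Cmod b ^ k * rho ^ n))%R by ring.
    apply Rmult_le_compat_l; auto.
    assert (0 < E1)%R by apply exp_pos. assert (0 < E2)%R by apply exp_pos.
    assert (0 <= B)%R by lra.
    assert (0 <= K1)%R.
    { assert (Hp : (0 < (rho * Cmod a) ^ n)%R) by (apply pow_lt, Rmult_lt_0_compat; lra).
      assert (HC := Cmod_ge_0 T). apply Rmult_le_reg_r with ((rho * Cmod a) ^ n)%R; auto. lra. }
    repeat apply Rmult_le_pos; lra.
Qed.

(** * Identification with the very-well-poised 8phi7 *)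

(** The factor of d_n in front of its 8phi7, already multiplied by (at, ct, dt; q)_oo. *)
Definition vwp_prefactor (q a b c d beta t : C) (n : nat) : C :=
  (t / a) ^ n * (qpoch beta q n * qpoch (a * c) q n * qpoch (a * d) q n)
  / qpoch (q ^ n * (a * b * c * d / q)) q n
  * (qpoch_inf (a * (beta * t) * q ^ n) q * qpoch_inf (c * (beta * t) * q ^ n) q
     * qpoch_inf (d * (beta * t) * q ^ n) q * qpoch_inf (a * c * d * t * q ^ n) q)
  / qpoch_inf (a * (beta * t) * c * d / q * q ^ (2 * n) * q) q.

(* [y] stands for a square root of the leading 8phi7 parameter. *)
Definition vwp_term (q a b c d beta t y : C) (n k : nat) : C :=
  qpoch (a * (beta * t) * c * d / q * q ^ (2 * n)) q k
  * (qpoch (y * q) q k * qpoch (- y * q) q k)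
  * (qpoch (a * c * q ^ n) q k * qpoch (a * d * q ^ n) q k * qpoch (c * d * q ^ n) q k
     * qpoch (beta * t / b) q k * qpoch (beta * q ^ n) q k)
  / (qpoch q q k * (qpoch y q k * qpoch (- y) q k)
     * (qpoch (a * (beta * t) * q ^ n) q k * qpoch (c * (beta * t) * q ^ n) q k
        * qpoch (d * (beta * t) * q ^ n) q k
        * qpoch (q ^ (2 * n + 1) * (a * b * c * d / q)) q k
        * qpoch (a * c * d * t * q ^ n) q k))
  * (b * t) ^ k.

(** The parameter pairs y q, -y q over y, -y contribute (1 - y^2 q^(2k)) / (1 - y^2), the
    very-well-poised factor, in which only y^2 appears. *)
Lemma vwp_pair (q y : C) k :
  qpoch (y * q) q k * qpoch (- y * q) q k * (1 - y * y)
  = qpoch y q k * qpoch (- y) q k * (1 - y * y * (q ^ k * q ^ k)).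
Proof.
  transitivity (((1 - y) * qpoch (y * q) q k) * ((1 - - y) * qpoch (- y * q) q k)); [ring|].
  rewrite <- !qpoch_Sl. cbn [qpoch]. ring.
Qed.

Lemma double_coef_vwp (q a b c d beta t y : C) n k :
  q <> 0 -> (Cmod q < 1)%R -> a <> 0 -> b <> 0 ->
  qregular q q -> qregular q (a * b * c * d / q) -> qregular q (a * (beta * t) * c * d / q) ->
  qregular q (c * d) -> qregular q y -> qregular q (- y) ->
  qregular q (a * (beta * t)) -> qregular q (c * (beta * t)) -> qregular q (d * (beta * t)) ->
  qregular q (a * c * d * t * q ^ n) ->
  y * y = a * (beta * t) * c * d / q * q ^ (2 * n) ->
  double_coef q a b c d (beta * t) t n k
  = vwp_prefactor q a b c d beta t n * vwp_term q a b c d beta t y n k.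
Proof.
  intros q0 Hq a0 b0 rq rD rA rcd ry ry' rag rcg rdg racdt Hy.
  assert (rN : forall x m, qregular q x -> qpoch x q m <> 0) by (intros; now apply qregular_neq0).
  assert (rI : forall x m, qregular q x -> qpoch_inf (x * q ^ m) q <> 0)
    by (intros; apply qpoch_inf_neq0, qregular_shift; auto).
  unfold double_coef, diagonal_weight, connection_coef, vwp_prefactor, vwp_term.
  replace (n + k - n)%nat with k by lia.
  set (A := a * (beta * t) * c * d / q) in *. set (D := a * b * c * d / q) in *.
  replace (newton t (beta * t) q (n + k)) with (t ^ n * t ^ k * (qpoch beta q n * qpoch (beta * q ^ n) q k)).
  2:{ rewrite <- qpoch_add, <- Cpow_add_r, <- newton_1, <- newton_scal.
      f_equal; ring. }
  replace (newton b (beta * t) q k) with (b ^ k * qpoch (beta * t / b) q k).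
  2:{ rewrite <- newton_1, <- newton_scal. f_equal; [ring | field; auto]. }
  rewrite (qpoch_add (a * c)), (qpoch_add (a * d)), (qpoch_add (c * d)).
  rewrite (qpoch_inf_split (a * (beta * t) * q ^ n) q k) by auto.
  rewrite (qpoch_inf_split (c * (beta * t) * q ^ n) q k) by auto.
  rewrite (qpoch_inf_split (d * (beta * t) * q ^ n) q k) by auto.
  rewrite (qpoch_inf_split (a * c * d * t * q ^ n) q k) by auto.
  rewrite <- !(Cmult_assoc _ (q ^ n) (q ^ k)), <- !(Cpow_add_r q n k).
  (* Both sides are referred to the tail (A q^(2n+k); q)_oo; the factor 1 - A q^(2n) left over by
     [E2] cancels the denominator from [vwp_pair]. *)
  assert (E1 : qpoch_inf (A * q ^ (n + k)) q
    = qpoch (A * q ^ (n + k)) q n * qpoch_inf (A * q ^ (2 * n + k)) q).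
  { rewrite (qpoch_inf_split (A * q ^ (n + k)) q n) by auto.
    rewrite <- Cmult_assoc, <- Cpow_add_r. do 4 f_equal. lia. }
  assert (E2 : (1 - A * q ^ (2 * n)) * qpoch_inf (A * q ^ (2 * n) * q) q
    = qpoch (A * q ^ (2 * n)) q k * qpoch_inf (A * q ^ (2 * n + k)) q).
  { rewrite <- qpoch_inf_step by auto. rewrite (qpoch_inf_split (A * q ^ (2 * n)) q k) by auto.
    now rewrite <- Cmult_assoc, <- Cpow_add_r. }
  assert (E3 := vwp_pair q y k). rewrite Hy in E3.
  replace (A * q ^ (2 * n) * (q ^ k * q ^ k)) with (A * (q ^ (n + k) * q ^ (n + k))) in E3.
  2:{ rewrite <- !Cpow_add_r, <- Cmult_assoc, <- Cpow_add_r. do 2 f_equal. lia. }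
  assert (n1 : 1 - A * q ^ (2 * n) <> 0) by (apply one_minus_neq0, rA).
  assert (n2 := rI A (2 * n + k)%nat rA).
  assert (n3 : qpoch_inf (A * q ^ (2 * n) * q) q <> 0).
  { rewrite <- Cmult_assoc, (Cmult_comm _ q), <- Cpow_S. now apply rI. }
  assert (n4 := rN (A * q ^ (n + k)) n (qregular_shift _ _ _ rA)).
  assert (n5 := rN y k ry). assert (n6 := rN (- y) k ry').
  assert (n7 := rN q k rq). assert (n8 := rN (c * d) n rcd).
  assert (n9 := rN (a * (beta * t) * q ^ n) k (qregular_shift _ _ _ rag)).
  assert (n10 := rN (c * (beta * t) * q ^ n) k (qregular_shift _ _ _ rcg)).
  assert (n11 := rN (d * (beta * t) * q ^ n) k (qregular_shift _ _ _ rdg)).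
  assert (n12 := rN (a * c * d * t * q ^ n) k racdt).
  assert (n13 : qpoch (q ^ n * D) q n <> 0) by (rewrite Cmult_comm; apply rN, qregular_shift; auto).
  assert (n14 : qpoch (q ^ (2 * n + 1) * D) q k <> 0)
    by (rewrite Cmult_comm; apply rN, qregular_shift; auto).
  assert (n15 : a ^ n <> 0) by now apply Cpow_nz.
  replace ((t / a) ^ n) with (t ^ n / a ^ n) by (unfold Cdiv; now rewrite Cpow_mult_l, Cpow_inv).
  rewrite (Cpow_mult_l b t k).
  rewrite E1.
  assert (E2' : qpoch (A * q ^ (2 * n)) q k
    = (1 - A * q ^ (2 * n)) * qpoch_inf (A * q ^ (2 * n) * q) q / qpoch_inf (A * q ^ (2 * n + k)) q)
    by (rewrite E2; field; auto).
  assert (E3' : qpoch (y * q) q k * qpoch (- y * q) q k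
    = qpoch y q k * qpoch (- y) q k * (1 - A * (q ^ (n + k) * q ^ (n + k)))
      / (1 - A * q ^ (2 * n)))
    by (rewrite <- E3; field; auto).
  rewrite E2', E3'. clear E1 E2 E3 E2' E3' Hy.
  clearbody A D.
  field. repeat split; auto.
Qed.

(** The hypothesis on [S] is an implication because convergence of the rows already follows from
    [double_term_bound]; what is left to supply is the value of each row sum. *)
Lemma ratio_double_series (q a b c d g t z z' : C) (S : nat -> C) :
  q <> 0 -> (Cmod q < 1)%R -> a <> 0 -> b <> 0 -> (Cmod b <= 1)%R ->
  z * z' = 1 -> Cmod z = 1%R -> (Cmod t < 1)%R ->
  qregular q q -> qregular q (a * b * c * d / q) -> qregular q (a * g * c * d / q) ->
  qregular q (c * d) ->
  qregular q (a * b) -> qregular q (a * c) -> qregular q (a * d) ->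
  qregular q (a * g) -> qregular q (c * g) -> qregular q (d * g) ->
  (forall n l, Cto (csum (double_term q a b c d g t z z' n)) l -> S n = l) ->
  Cto (csum S)
    (qpoch_inf (a * t) q * qpoch_inf (c * t) q * qpoch_inf (d * t) q
     * (qpoch_inf (g * z) q * qpoch_inf (g * z') q
        / (qpoch_inf (t * z) q * qpoch_inf (t * z') q))).
Proof.
  intros q0 Hq a0 b0 Mb Hz Mz Ht rq rD rA rcd rab rac rad rag rcg rdg HS.
  destruct (double_term_bound q a b c d g t z z') as [K [r [Hr HK]]]; auto.
  apply series_by_diagonals with (double_term q a b c d g t z z') K r; auto.
  - intros n.
    destruct (geo_series (double_term q a b c d g t z z' n) (K * r ^ n) r Hr) as [l Hl].
    { intros k. rewrite Rmult_assoc, <- pow_add. apply HK. }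
    now rewrite (HS n l Hl).
  - eapply Cto_ext; [|now apply ratio_expansion].
    intros M. apply csum_ext. intros N _. symmetry. now apply double_term_diagonal.
Qed.

(** * Specialization to continuous q-Jacobi polynomials *)

(** Here ab = q^(1/2) alpha and abcd/q = alpha gamma; the parameter q^(-n) terminates the series, so
    the limit in [rphis] is a finite sum. *)
Lemma cqJacobi_aw_poly (alpha gamma q q12 al12 ga12 : C) (n : nat) (x : R) :
  q <> 0 -> q12 ^ 2 = q -> al12 ^ 2 = alpha -> ga12 ^ 2 = gamma ->
  cqJacobi alpha gamma q q12 al12 ga12 n x
  = qpoch (al12 * (q12 * al12)) q n / qpoch q q n
    * aw_poly q al12 (q12 * al12) (- ga12) (- (q12 * ga12))
        (expi (acos x)) (expi (- acos x)) n.
Proof.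
  intros q0 hq12 hal12 hga12.
  assert (E0 : al12 * (q12 * al12) = q12 * alpha) by (rewrite <- hal12; simpl; ring).
  assert (E1 : al12 * - ga12 = - (al12 * ga12)) by ring.
  assert (E2 : al12 * - (q12 * ga12) = - (q12 * al12 * ga12)) by ring.
  assert (E3 : al12 * (q12 * al12) * - ga12 * - (q12 * ga12) / q = alpha * gamma).
  { rewrite <- hal12, <- hga12, <- hq12. field. intros E; apply q0.
    rewrite <- hq12, E. simpl; ring. }
  unfold cqJacobi, rphis. rewrite E0. f_equal.
  rewrite (finite_Csum_inf _ n).
  - unfold aw_poly. apply csum_ext. intros j _.
    unfold aw_coef, aw_basis. rewrite E3, E0, E1, E2.
    unfold qpochs. simpl (1 + _ - _)%Z. simpl Cprod. simpl Cpowz.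
    replace (q ^ n * alpha * gamma) with (alpha * gamma * q ^ n) by ring.
    unfold Cdiv. rewrite !Cmult_1_r, !Cmult_assoc. ring.
  - intros k Hk. unfold qpochs at 1. simpl Cprod. rewrite qpoch_neg_power_vanish by auto.
    unfold Cdiv. ring.
Qed.

Lemma vwp_term_Phi (beta t alpha gamma q q12 q14 al12 al14 ga12 w : C) (n k : nat) :
  q <> 0 -> q14 <> 0 -> al12 <> 0 -> q12 <> 0 ->
  q12 ^ 2 = q -> q14 ^ 2 = q12 -> al12 ^ 2 = alpha -> ga12 ^ 2 = gamma ->
  qpochs (Phi_upper beta t alpha gamma q q12 q14 al12 al14 ga12 w n) q k
  / qpochs (q :: Phi_lower beta t alpha gamma q q12 q14 al12 al14 ga12 w n) q k
  * Cpowz ((- (1)) ^ k * q ^ Nat.div2 (k * (k - 1)))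
      (1 + Z.of_nat (length (Phi_lower beta t alpha gamma q q12 q14 al12 al14 ga12 w n))
       - Z.of_nat (length (Phi_upper beta t alpha gamma q q12 q14 al12 al14 ga12 w n)))
  * (q12 * al12 * t) ^ k
  = vwp_term q al12 (q12 * al12) (- ga12) (- (q12 * ga12)) beta t (q ^ n / q14 * al14 * w) n k.
Proof.
  intros q0 q140 al0 q120 hq12 hq14 hal12 hga12.
  assert (E1 : q ^ (2 * n) / q12 * al12 * gamma * beta * t
    = al12 * (beta * t) * - ga12 * - (q12 * ga12) / q * q ^ (2 * n)).
  { rewrite <- hga12. generalize (q ^ (2 * n)). intros Q. rewrite <- hq12. field. auto. }
  assert (E2 : q ^ n * q14 ^ 3 * al14 * w = q ^ n / q14 * al14 * w * q).
  { generalize (q ^ n). intros Q. rewrite <- hq12, <- hq14. field. auto. }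
  assert (E3 : - (q ^ n / q14 * al14 * w * q) = - (q ^ n / q14 * al14 * w) * q) by ring.
  assert (E4 : - (q ^ n * al12 * ga12) = al12 * - ga12 * q ^ n) by ring.
  assert (E5 : - (q ^ n * q12 * al12 * ga12) = al12 * - (q12 * ga12) * q ^ n) by ring.
  assert (E6 : q ^ n * q12 * gamma = - ga12 * - (q12 * ga12) * q ^ n) by (rewrite <- hga12; ring).
  assert (E7 : / (q12 * al12) * beta * t = beta * t / (q12 * al12)) by (field; auto).
  assert (E8 : q ^ n * beta = beta * q ^ n) by ring.
  assert (E9 : q ^ n * al12 * beta * t = al12 * (beta * t) * q ^ n) by ring.
  assert (E10 : - (q ^ n * ga12 * beta * t) = - ga12 * (beta * t) * q ^ n) by ring.
  assert (E11 : - (q ^ n * q12 * ga12 * beta * t) = - (q12 * ga12) * (beta * t) * q ^ n) by ring.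
  assert (E12 : q ^ (2 * n + 1) * alpha * gamma
    = q ^ (2 * n + 1) * (al12 * (q12 * al12) * - ga12 * - (q12 * ga12) / q)).
  { rewrite <- hga12, <- hal12. generalize (q ^ (2 * n + 1)). intros Q. rewrite <- hq12.
    field. auto. }
  assert (E13 : q ^ n * q12 * al12 * gamma * t = al12 * - ga12 * - (q12 * ga12) * t * q ^ n)
    by (rewrite <- hga12; ring).
  unfold qpochs, Phi_upper, Phi_lower.
  rewrite E1, E2, E3, E4, E5, E6, E7, E8, E9, E10, E11, E12, E13.
  (* For an 8phi7 the exponent 1 + 7 - 8 is 0. *)
  match goal with |- context [Cpowz ?x ?z] => change (Cpowz x z) with (RtoC 1) end.
  unfold Cprod, vwp_term, Cdiv. cbn [map fold_right].
  rewrite !Cmult_1_r, !Cmult_assoc. ring.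
Qed.

(** [theta] is any angle with cosine x and need not be acos x; the quotient is symmetric under theta
    -> -theta, so knowing the sine up to sign is enough. *)
Lemma sin_eq_or_opp (u v : R) : cos u = cos v -> sin u = sin v \/ sin u = (- sin v)%R.
Proof.
  intros H. assert (Hu := sin2_cos2 u). assert (Hv := sin2_cos2 v). unfold Rsqr in *.
  rewrite H in Hu.
  assert (E : ((sin u - sin v) * (sin u + sin v) = 0)%R) by lra.
  apply Rmult_integral in E. destruct E; [left | right]; lra.
Qed.

Lemma expi_mul_opp (u : R) : expi u * expi (- u) = 1.
Proof.
  unfold expi. rewrite cos_neg, sin_neg. assert (H := sin2_cos2 u). unfold Rsqr in H.
  apply injective_projections; simpl; lra.
Qed.

Lemma Cmod_expi (u : R) : Cmod (expi u) = 1%R.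
Proof.
  unfold Cmod, expi. simpl. rewrite !Rmult_1_r.
  assert (H := sin2_cos2 u). unfold Rsqr in H. rewrite Rplus_comm, H. apply sqrt_1.
Qed.

(** As |beta| is unrestricted, denominators containing it could vanish; [hdef] excludes this. The
    denominators of the polynomials stay nonzero by the bounds on q, alpha and gamma. *)
Theorem mainTheorem4
    (q t beta alpha gamma : C)
    (q12 q14 al12 al14 ga12 w : C)
    (x theta : R)
    (hq : (0 < Cmod q < 1)%R)
    (ht : (Cmod t < 1)%R)
    (halpha : (0 < Cmod alpha < 1)%R)
    (hgamma : (Cmod gamma < 1)%R)
    (hx : (-1 <= x <= 1)%R)
    (hxtheta : x = cos theta)
    (hq12 : q12 ^ 2 = q) (hq14 : q14 ^ 2 = q12)
    (hal12 : al12 ^ 2 = alpha) (hal14 : al14 ^ 2 = al12)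
    (hga12 : ga12 ^ 2 = gamma)
    (hw : w ^ 2 = gamma * beta * t)
    (hdef : forall n : nat,
       List.Forall (qregular q)
         (d_lower beta t gamma q q12 al12 ga12 n
          ++ Phi_lower beta t alpha gamma q q12 q14 al12 al14 ga12 w n)) :
  is_series
    (fun n : nat =>
       d_coef beta t alpha gamma q q12 q14 al12 al14 ga12 w n
       * cqJacobi alpha gamma q q12 al12 ga12 n x)
    (qpochs_inf [t * beta * expi theta; t * beta * expi (- theta)] q
     / qpochs_inf [t * expi theta; t * expi (- theta)] q).
Proof.
  assert (q0 : q <> 0) by (apply Cmod_gt_0; lra).
  assert (al0 : al12 <> 0).
  { intros E. apply (proj2 (Cmod_gt_0 alpha)); [lra|]. rewrite <- hal12, E. simpl. ring. }
  assert (q120 : q12 <> 0) by (intros E; apply q0; rewrite <- hq12, E; simpl; ring).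
  assert (q140 : q14 <> 0) by (intros E; apply q120; rewrite <- hq14, E; simpl; ring).
  assert (Hsq : forall u v, u ^ 2 = v -> (Cmod v < 1)%R -> (Cmod u < 1)%R).
  { intros u v E Hv. rewrite <- E, Cmod_pow in Hv. assert (H := Cmod_ge_0 u). simpl in Hv. nra. }
  assert (Mq12 := Hsq _ _ hq12 (proj2 hq)). assert (Mal := Hsq _ _ hal12 (proj2 halpha)).
  assert (Mga := Hsq _ _ hga12 hgamma).
  assert (Hm : forall u v, (Cmod u < 1)%R -> (Cmod v < 1)%R -> (Cmod (u * v) < 1)%R).
  { intros u v Hu Hv. rewrite Cmod_mult.
    assert (H1 := Cmod_ge_0 u). assert (H2 := Cmod_ge_0 v). nra. }
  assert (Ho : forall u, (Cmod u < 1)%R -> (Cmod (- u) < 1)%R)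
    by (intros u Hu; now rewrite Cmod_opp).
  assert (Hq := proj2 hq).
  set (a := al12). set (b := q12 * al12). set (c := - ga12). set (d := - (q12 * ga12)).
  assert (Ma : (Cmod a < 1)%R) by exact Mal.
  assert (Mb : (Cmod b < 1)%R) by (unfold b; auto).
  assert (Mc : (Cmod c < 1)%R) by (unfold c; auto).
  assert (Md : (Cmod d < 1)%R) by (unfold d; auto).
  assert (rs : forall u, (Cmod u < 1)%R -> qregular q u) by (intros; now apply small_regular).
  assert (ED : a * b * c * d / q = alpha * gamma).
  { unfold a, b, c, d. rewrite <- hal12, <- hga12, <- hq12. field. auto. }
  assert (EA : forall n, q ^ (2 * n) * q12 * al12 * gamma * beta * t
    = a * (beta * t) * c * d / q * q ^ (2 * n) * q).
  { intros n. unfold a, c, d. generalize (q ^ (2 * n)). intros Q.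
    rewrite <- hga12. field. auto. }
  set (A := a * (beta * t) * c * d / q) in *.
  set (y := fun n => q ^ n / q14 * al14 * w).
  assert (Ey : forall n, y n * y n = A * q ^ (2 * n)).
  { intros n. unfold y, A, a, c, d. replace (2 * n)%nat with (n + n)%nat by lia.
    rewrite Cpow_add_r. generalize (q ^ n). intros Q.
    transitivity (Q * Q / (q14 ^ 2) * al14 ^ 2 * w ^ 2); [field; auto|].
    rewrite hq14, hal14, hw, <- hga12, <- hq12. field. auto. }
  assert (R : forall n, qregular q (y n) /\ qregular q (- y n)
    /\ qregular q (a * (beta * t) * q ^ n) /\ qregular q (c * (beta * t) * q ^ n)
    /\ qregular q (d * (beta * t) * q ^ n) /\ qregular q (a * c * d * t * q ^ n)
    /\ qregular q (A * q ^ (2 * n) * q)).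
  { intros n. specialize (hdef n). unfold d_lower, Phi_lower in hdef. cbn [app] in hdef.
    rewrite (EA n) in hdef.
    repeat (apply Forall_cons_iff in hdef; let H := fresh "H" in destruct hdef as [H hdef]).
    unfold y, a, c, d. rewrite <- hga12 in *.
    repeat split; try assumption;
    match goal with H : qregular q ?u |- qregular q ?v =>
      replace v with u; [exact H | solve [ring]] end. }
  (* For even powers A q^(2n) = (y n)^2, and 1 - y^2 = (1 - y) (1 + y) with both factors nonzero by
     [Phi_lower]; for odd powers A q^(2n+1) is the last entry of [d_lower]. All n are needed to
     reach every power. *)
  assert (rA : qregular q A).
  { intros k. destruct (Nat.Even_or_Odd k) as [[n ->] | [n ->]].
    - destruct (R n) as [R1 [R2 _]]. specialize (R1 O). specialize (R2 O).
      simpl in R1, R2. rewrite Cmult_1_r in R1, R2.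
      apply one_minus_neq0 in R1. apply one_minus_neq0 in R2.
      intros E. apply (Cmult_neq_0 _ _ R1 R2).
      transitivity (1 - y n * y n); [ring|]. rewrite Ey, E. ring.
    - destruct (R n) as [_ [_ [_ [_ [_ [_ R7]]]]]]. specialize (R7 O).
      rewrite Nat.add_1_r, Cpow_S. intros E. apply R7. rewrite <- E. simpl (q ^ 0). ring. }
  assert (rD : qregular q (a * b * c * d / q)).
  { rewrite ED. apply rs, Hm; [apply halpha | auto]. }
  assert (rq : qregular q q) by auto.
  destruct (R O) as [_ [_ [rag [rcg [rdg _]]]]]. simpl (q ^ 0) in rag, rcg, rdg.
  rewrite Cmult_1_r in rag, rcg, rdg.
  set (z := expi (acos x)). set (z' := expi (- acos x)).
  assert (Hz : z * z' = 1) by apply expi_mul_opp.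
  assert (Mz : Cmod z = 1%R) by apply Cmod_expi.
  (* The normalizing product carried by the expansion coefficients; it is divided out at the end,
     being nonzero since a t, c t and d t have modulus below 1. *)
  set (P := qpoch_inf (a * t) q * qpoch_inf (c * t) q * qpoch_inf (d * t) q).
  assert (nP : P <> 0) by (repeat apply Cmult_neq_0; apply qpoch_inf_neq0; auto).
  set (J := fun n => qpoch (a * b) q n / qpoch q q n * aw_poly q a b c d z z' n).
  assert (EJ : forall n, cqJacobi alpha gamma q q12 al12 ga12 n x = J n)
    by (intros n; now apply cqJacobi_aw_poly).
  assert (Ed : forall n, P * d_coef beta t alpha gamma q q12 q14 al12 al14 ga12 w n
    = vwp_prefactor q a b c d beta t n * Phi beta t alpha gamma q q12 q14 al12 al14 ga12 w n).
  { intros n. destruct (R n) as [_ [_ [_ [_ [_ [_ R7]]]]]].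
    apply (qpoch_inf_neq0 _ _ Hq) in R7.
    unfold d_coef, d_lower, vwp_prefactor, qpochs_inf, qpochs, Cprod. cbn [map fold_right].
    rewrite (EA n), ED. fold A.
    replace (- (al12 * ga12)) with (a * c) by (unfold a, c; ring).
    replace (- (q12 * al12 * ga12)) with (a * d) by (unfold a, d; ring).
    replace (q ^ n * al12 * beta * t) with (a * (beta * t) * q ^ n) by (unfold a; ring).
    replace (- (q ^ n * ga12 * beta * t)) with (c * (beta * t) * q ^ n) by (unfold c; ring).
    replace (- (q ^ n * q12 * ga12 * beta * t)) with (d * (beta * t) * q ^ n) by (unfold d; ring).
    replace (q ^ n * q12 * al12 * gamma * t) with (a * c * d * t * q ^ n)
      by (unfold a, c, d; rewrite <- hga12; ring).
    change (al12 * t) with (a * t). change (t / al12) with (t / a).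
    replace (- (ga12 * t)) with (c * t) by (unfold c; ring).
    replace (- (q12 * ga12 * t)) with (d * t) by (unfold d; ring).
    replace (q ^ n * alpha * gamma) with (q ^ n * (alpha * gamma)) by ring.
    unfold P in *.
    assert (n1 : qpoch_inf (a * t) q <> 0) by (apply qpoch_inf_neq0; auto).
    assert (n2 : qpoch_inf (c * t) q <> 0) by (apply qpoch_inf_neq0; auto).
    assert (n3 : qpoch_inf (d * t) q <> 0) by (apply qpoch_inf_neq0; auto).
    assert (n4 : qpoch (q ^ n * (alpha * gamma)) q n <> 0).
    { rewrite <- ED, Cmult_comm. apply qregular_neq0, qregular_shift; auto. }
    field. repeat split; auto. }
  assert (Hmain : Cto (csum (fun n => P * (d_coef beta t alpha gamma q q12 q14 al12 al14 ga12 w n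
      * cqJacobi alpha gamma q q12 al12 ga12 n x)))
    (P * (qpoch_inf (beta * t * z) q * qpoch_inf (beta * t * z') q
          / (qpoch_inf (t * z) q * qpoch_inf (t * z') q)))).
  { apply (ratio_double_series q a b c d (beta * t) t z z'); auto; try lra.
    - now apply Cmult_neq_0.
    - intros n l Hl. destruct (R n) as [R1 [R2 [_ [_ [_ [R6 _]]]]]].
      rewrite EJ, Cmult_assoc, Ed.
      set (pre := vwp_prefactor q a b c d beta t n).
      assert (Hl' : Cto (fun m => pre * J n * csum (vwp_term q a b c d beta t (y n) n) m) l).
      { eapply Cto_ext; [|exact Hl]. intros m. rewrite <- csum_scal. apply csum_ext. intros k _.
        unfold double_term.
        rewrite (double_coef_vwp q a b c d beta t (y n) n k); auto;
          [|now apply Cmult_neq_0]. unfold pre, J. ring. }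
      (* When [pre * J n = 0], the convergence of the 8phi7 cannot be inferred from that of the
         double series, but its value is irrelevant. *)
      destruct (Ceq_dec (pre * J n) 0) as [E0|N0].
      + transitivity (pre * J n * Phi beta t alpha gamma q q12 q14 al12 al14 ga12 w n); [ring|].
        rewrite E0, Cmult_0_l. apply Cto_unique with (fun _ => RtoC 0); [apply Cto_const|].
        eapply Cto_ext; [|exact Hl']. intros m. cbv beta. rewrite E0. ring.
      + assert (EPhi : Phi beta t alpha gamma q q12 q14 al12 al14 ga12 w n = / (pre * J n) * l).
        { apply csum_Csum_inf.
          apply Cto_ext with (fun m => / (pre * J n)
            * (pre * J n * csum (vwp_term q a b c d beta t (y n) n) m)).
          - intros m. transitivity (csum (vwp_term q a b c d beta t (y n) n) m).
            + field. repeat split; intros E; apply N0; rewrite E; ring.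
            + apply csum_ext. intros k _. symmetry. now apply vwp_term_Phi.
          - now apply Cto_scal. }
        rewrite EPhi. field. repeat split; intros E; apply N0; rewrite E; ring. }
  assert (EL : qpochs_inf [t * beta * expi theta; t * beta * expi (- theta)] q
     / qpochs_inf [t * expi theta; t * expi (- theta)] q
    = qpoch_inf (beta * t * z) q * qpoch_inf (beta * t * z') q
          / (qpoch_inf (t * z) q * qpoch_inf (t * z') q)).
  { unfold qpochs_inf, Cprod. cbn [map fold_right]. rewrite !Cmult_1_r, !(Cmult_comm t beta).
    assert (Hcos : cos theta = cos (acos x)) by (rewrite cos_acos by lra; auto).
    unfold z, z'. destruct (sin_eq_or_opp _ _ Hcos) as [Hsin|Hsin].
    - replace (expi theta) with (expi (acos x)) by (unfold expi; now rewrite Hcos, Hsin).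
      replace (expi (- theta)) with (expi (- acos x))
        by (unfold expi; now rewrite !cos_neg, !sin_neg, Hcos, Hsin).
      reflexivity.
    - replace (expi theta) with (expi (- acos x))
        by (unfold expi; now rewrite cos_neg, sin_neg, Hcos, Hsin).
      replace (expi (- theta)) with (expi (acos x))
        by (unfold expi; now rewrite cos_neg, sin_neg, Hcos, Hsin, Ropp_involutive).
      rewrite (Cmult_comm (qpoch_inf (beta * t * expi (- acos x)) q)).
      now rewrite (Cmult_comm (qpoch_inf (t * expi (- acos x)) q)). }
  rewrite EL. apply Cto_is_series.
  apply Cto_ext with (fun m => / P * csum (fun n => P
    * (d_coef beta t alpha gamma q q12 q14 al12 al14 ga12 w n
       * cqJacobi alpha gamma q q12 al12 ga12 n x)) m).
  - intros m. rewrite csum_scal, Cmult_assoc, Cinv_l, Cmult_1_l; auto.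
  - eapply Cto_eq; [apply Cto_scal, Hmain|].
    rewrite Cmult_assoc, Cinv_l, Cmult_1_l; auto.
Qed.
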